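(* For each $n$ let $\delta$ be a uniformly random transition function of an automaton with state set $[n]$ and alphabet $\{a,b\}$, and let $X$ denote the length of the shortest synchronizing word of this automaton. There exists a universal constant $C>0$ such that for every $0<\varepsilon\le 1$ there is $n_0(\varepsilon)$ such that for all $n\ge n_0(\varepsilon)$, $$\Pr\bigl(X\le C\varepsilon^{-1}\sqrt{n\log n}\bigr)\ge 1-\varepsilon.$$ (The constant $C$ does not depend on $\varepsilon$.)
   Context: $[n]=\{1,\dots,n\}$. A random automaton on state set $[n]$ with alphabet $\{a,b\}$ is given by a transition function $\delta:[n]\times\{a,b\}\to[n]$ chosen uniformly among all $n^{2n}$ such functions; equivalently, the values $\delta_c(x):=\delta(x,c)$, for $x\in[n]$, $c\in\{a,b\}$, are independent and uniform on $[n]$. For a word $\omega=\omega_1\omega_2\cdots\omega_m\in\{a,b\}^*$ put $\delta_\omega:=\delta_{\omega_m}\circ\cdots\circ\delta_{\omega_1}$, and for $B\subseteq[n]$ put $\delta_\omega(B):=\{\delta_\omega(x):x\in B\}$. A synchronizing word is a word $\omega\in\{a,b\}^*$ with $|\delta_\omega([n])|=1$; $X=\infty$ if there is none. The base of the logarithm is immaterial, since changing it only changes $C$. *)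

(* Defs.v *)
From HB Require Import structures.
From mathcomp Require Import all_boot all_order all_algebra.
From mathcomp Require Import all_classical all_reals all_analysis.
Set Implicit Arguments.
Unset Strict Implicit.
Unset Printing Implicit Defensive.
Import Order.TTheory GRing.Theory Num.Theory.
Local Open Scope ring_scope.

(* The two-letter alphabet {a, b} is bool and the state set [n] is 'I_n. *)
Definition automaton (n : nat) := {ffun 'I_n * bool -> 'I_n}.

(* Letters are read from left to right: the head of w acts first. *)
Definition delta_word (n : nat) (delta : automaton n) (w : seq bool) (x : 'I_n) : 'I_n :=
  foldl (fun y c => delta (y, c)) x w.

Definition synchronizing (n : nat) (delta : automaton n) (w : seq bool) : bool :=
  #|[set delta_word delta w x | x : 'I_n]| == 1%N.

(* ereal_inf set0 = +oo, so the value is +oo when no word synchronizes; otherwise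
   the infimum is attained, see shortest_sync_attained. *)
Definition shortest_sync (R : realType) (n : nat) (delta : automaton n) : \bar R :=
  ereal_inf [set ((size w)%:R)%:E | w in [set w : seq bool | synchronizing delta w]]%classic.

Definition uniform_pr (R : realType) (T : finType) (E : {set T}) : R :=
  #|E|%:R / #|T|%:R.

Lemma shortest_sync_attained (R : realType) (n : nat) (delta : automaton n) (w0 : seq bool) :
  synchronizing delta w0 ->
  exists2 w, synchronizing delta w &
    shortest_sync R delta = ((size w)%:R)%:E /\
    forall v, synchronizing delta v -> (size w <= size v)%N.
Proof.
move=> sync0.
have ex : exists k, `[< exists2 w, synchronizing delta w & size w = k >].
  by exists (size w0); apply/asboolP; exists w0.
case: (ex_minnP ex) => k /asboolP[w syncw <-] kmin.
have wmin v : synchronizing delta v -> (size w <= size v)%N.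
  by move=> syncv; apply: kmin; apply/asboolP; exists v.
exists w => //; split=> //; apply/eqP; rewrite eq_le; apply/andP; split.
  by apply: ereal_inf_lbound; exists w.
by apply: le_ereal_inf_tmp => _ [v /= syncv <-]; rewrite lee_fin ler_nat; exact: wmin.
Qed.

Lemma shortest_sync_pinfty (R : realType) (n : nat) (delta : automaton n) :
  (forall w, ~~ synchronizing delta w) -> shortest_sync R delta = +oo%E.
Proof.
move=> nosync; rewrite /shortest_sync (_ : image _ _ = set0) ?ereal_inf0 //.
by apply/seteqP; split=> // _ [w /= + _]; apply/negP; exact: nosync.
Qed.

(* Main.v *)
(** Let [a] and [b] be the two random maps and [n] the number of states.

    Reduction to few states.  With [t ~ sqrt n] and [k ~ sqrt (log n) / eps], read the word
    [a^t b a^t b^2 a^t ... b^k a^t].  The image of [a^t] has [N = O(sqrt n)] elements, because the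
    height of a vertex of the graph of [a] is dominated by that of a critical Galton-Watson tree.
    Once [a] is known, the points [b^j c], with [c] in that image, are fresh uniform states up to
    few coincidences, so that each round throws the [m] remaining states into [N] cells; the
    harmonic decrease [m <= 4 N / (j + 1)] follows, whatever the probabilities of the cells are.

    Merging the rest.  The [O(sqrt (n / log n))] remaining states are merged two at a time.  From
    a pair [(u, v)], take [r ~ log n] disjoint pairs [(a^i u, a^i v)] as roots, and reveal [b]
    along the binary tree of words over [{b, b a}].  As long as few states are revealed a node
    has two fresh children with probability close to 1, so the trees together grow to order [n]
    fresh pairs.  Each of them is merged by [b a^s] with probability at least [1 / #|image of a^s|],
    which is of order [eps s / n].  For [s ~ log n / eps] a root fails with probability at most
    [3 / 4], and all of them fail with probability at most [n^-3], small enough for a union bound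
    over all pairs.

    All estimates on [a] are first or second moments, which is where the factor [1 / eps] in the
    length comes from. *)

Require Import Defs.
From HB Require Import structures.
From mathcomp Require Import all_classical all_reals all_analysis.
From mathcomp Require Import all_boot all_order all_algebra.
From mathcomp Require Import zify ring lra.
Set Implicit Arguments.
Unset Strict Implicit.
Unset Printing Implicit Defensive.
Import Order.TTheory GRing.Theory Num.Theory.
Local Open Scope ring_scope.

(** * Functions with independent values *)

Section ProductFamilies.
Variables (R : realFieldType) (T : finType).
Implicit Types (V : T -> {set T}) (f : {ffun T -> T}) (E : {set {ffun T -> T}}) (A : {set T}).

Definition fam V : {set {ffun T -> T}} := [set f : {ffun T -> T} | [forall x, f x \in V x]].

(* A family [V] records what has been revealed about a random function: [V x] is the set of values
   still possible at [x], a singleton once the value is known and [setT] while it is fresh. *)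
Definition upd V x (A : {set T}) : T -> {set T} := fun z => if z == x then A else V z.

(** Conditional probabilities are handled without division: counts inside [fam V] are compared with
    [wt V], the size of that family. *)
Definition wt V : R := \prod_x #|V x|%:R.

Lemma famP V f : reflect (forall x, f x \in V x) (f \in fam V).
Proof. by rewrite inE; exact: forallP. Qed.

Lemma card_fam V : #|fam V|%:R = wt V.
Proof.
have -> : #|fam V| = #|family (fun x => mem (V x))|.
  by apply: eq_card => f; apply/famP/familyP => h x; move: (h x); rewrite ?inE.
by rewrite card_family foldrE big_map big_enum natr_prod.
Qed.

Lemma upd_same V x A : upd V x A x = A.
Proof. by rewrite /upd eqxx. Qed.

Lemma upd_other V x A z : z != x -> upd V x A z = V z.
Proof. by rewrite /upd => /negbTE ->. Qed.

Lemma wt_ge0 V : 0 <= wt V.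
Proof. by apply: prodr_ge0 => x _; exact: ler0n. Qed.

Definition wt_rest V x : R := \prod_(z | z != x) #|V z|%:R.

Lemma wtE V x : wt V = #|V x|%:R * wt_rest V x.
Proof. by rewrite /wt (bigD1 x). Qed.

Lemma wt_upd V x A : wt (upd V x A) = #|A|%:R * wt_rest V x.
Proof.
rewrite (wtE _ x) upd_same; congr (_ * _).
by apply: eq_bigr => z zx; rewrite upd_other.
Qed.

Lemma fam_upd V x A f : A \subset V x ->
  (f \in fam (upd V x A)) = (f \in fam V) && (f x \in A).
Proof.
move=> /subsetP AV; apply/famP/andP => [h|[/famP h fx] z].
  split; last by move: (h x); rewrite upd_same.
  apply/famP => z; have := h z; rewrite /upd; case: eqP => // ->; exact: AV.
by rewrite /upd; case: eqP => // ->.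
Qed.

(** Reveals only whether [f x] lies in [A], leaving the value itself undecided within that part. *)
Lemma fam_split V x A E :
  #|fam V :&: E| = (#|fam (upd V x (V x :&: A)) :&: E|
                  + #|fam (upd V x (V x :\: A)) :&: E|)%N.
Proof.
rewrite -(cardsID [set f : {ffun T -> T} | f x \in A]); congr (_ + _)%N;
  apply: eq_card => f; rewrite !(in_setI, in_setD) fam_upd ?subsetIl ?subsetDl //;
  rewrite !(in_setI, in_setD); case fV: (f \in fam V); rewrite /= ?andbF //;
  by rewrite [f \in [set _ | _]]inE (famP _ _ fV x) ?andbT andbC.
Qed.

Lemma fam_reveal V x E :
  #|fam V :&: E| = (\sum_(y in V x) #|fam (upd V x [set y]) :&: E|)%N.
Proof.
rewrite -sum1_card (partition_big (fun f : {ffun T -> T} => f x) (mem (V x))) /=; last first.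
  by move=> f; rewrite inE => /andP[/famP].
apply: eq_bigr => y yV; rewrite -sum1_card; apply: eq_bigl => f.
by rewrite !in_setI fam_upd ?sub1set // inE andbAC.
Qed.

End ProductFamilies.

(** * Heights in a random functional graph *)

Section Survival.
Variables (R : realType) (T : finType).
Implicit Types (V : T -> {set T}) (f : {ffun T -> T}) (L W : {set T}).

(** Iterated from [L], this yields the generations of the backward tree of [f]: generation [t] holds
    the points that reach [L] in [t] steps through [W]. *)
Definition pre f W L : {set T} := [set x in W | f x \in L].

(* Dominates the probability that a Galton-Watson tree with Poisson(1) offspring reaches
   generation [t]. *)
Definition survival (t : nat) : R := 4 / (t%:R + 4).

Lemma survival_gt0 t : 0 < survival t.
Proof. by rewrite /survival divr_gt0 // ltr_wpDl. Qed.

Lemma survival_le1 t : survival t <= 1.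
Proof. by rewrite /survival ler_pdivrMr ?ltr_wpDl // mul1r lerDr. Qed.

(** A Poisson(1) tree obeys [1 - s_{t+1} = exp (- s_t)]; the right-hand side is the polynomial lower
    bound of that exponential which [binomial_miss] works with. *)
Lemma survivalS t : 1 - survival t.+1 <= (1 - survival t / 2) ^+ 2.
Proof.
rewrite /survival -[t.+1]addn1 natrD; set m : R := t%:R.
have m0 : 0 <= m by exact: ler0n.
have -> : 1 - 4 / (m + 1%:R + 4) = (m + 1) / (m + 5) by field; lra.
have -> : (1 - 4 / (m + 4) / 2) ^+ 2 = (m + 2) ^+ 2 / (m + 4) ^+ 2 by field; lra.
rewrite ler_pdivrMr; last by lra.
rewrite mulrAC.
rewrite ler_pdivlMr; last by rewrite exprn_gt0 //; lra.
rewrite -subr_ge0; have -> : (m + 2) ^+ 2 * (m + 5) - (m + 1) * (m + 4) ^+ 2 = 4 by ring.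
by [].
Qed.

(* [1 - x >= exp (- x / (1 - x))] and [exp (- s) >= (1 - s / 2) ^ 2] *)
Lemma binomial_miss (s : R) (l v p : nat) : 0 <= s <= 1 -> (p + l <= v)%N ->
  (1 - s / 2) ^+ (2 * l) <= (1 - s * l%:R / v%:R) ^+ p.
Proof.
move=> /andP[s0 s1] plv; have h0 : 0 <= 1 - s / 2 by lra.
have h1 : 1 - s / 2 <= 1 by lra.
case: p plv => [|p] plv; first by rewrite expr0 exprn_ile1.
have v0 : 0 < v%:R :> R by rewrite ltr0n; lia.
have lv : l%:R + p.+1%:R <= v%:R :> R by rewrite -natrD ler_nat; lia.
have l0 : 0 <= l%:R :> R by [].
have p0 : 0 < p.+1%:R :> R by [].
have sl : s * l%:R <= l%:R by rewrite ler_piMl.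
set x := s * l%:R / v%:R.
have x0 : 0 <= x by rewrite divr_ge0 ?mulr_ge0 // ltW.
have xE : x * v%:R = s * l%:R by rewrite /x divfK // gt_eqF.
have x1 : 0 < 1 - x.
  by rewrite -(pmulr_lgt0 _ v0) mulrBl mul1r xE; lra.
set y := x / (1 - x).
have y0 : 0 <= y by rewrite divr_ge0 // ltW.
have e1 : expR (- y) <= 1 - x.
  rewrite expRN -[leRHS]invrK lef_pV2 ?posrE ?invr_gt0 ?expR_gt0 //.
  have -> : (1 - x)^-1 = 1 + y by rewrite /y; field; rewrite gt_eqF.
  exact: expR_ge1Dx.
have e2 : (1 - s / 2) ^+ 2 <= expR (- s).
  have -> : expR (- s) = expR (- (s / 2)) ^+ 2.
    by rewrite -expRM_natl; congr expR; field.
  by rewrite lerXn2r ?nnegrE ?expR_ge0 //; exact: expR_ge1Dx.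
apply: (@le_trans _ _ (expR (- s) ^+ l)).
  by rewrite exprM lerXn2r ?nnegrE ?exprn_ge0 ?expR_ge0.
apply: (@le_trans _ _ (expR (- y) ^+ p.+1)); last first.
  by rewrite lerXn2r ?nnegrE ?expR_ge0 // ltW.
rewrite -!expRM_natl ler_expR !mulrN lerN2.
rewrite /y mulrA ler_pdivrMr // -(ler_pM2r v0) -mulrA xE -[leRHS]mulrA mulrBl mul1r xE.
by rewrite mulrC [l%:R * s]mulrC ler_wpM2l ?mulr_ge0 //; lra.
Qed.

End Survival.

Section Heights.
Variables (R : realType) (T : finType).
Implicit Types (V : T -> {set T}) (f : {ffun T -> T}) (L W P : {set T}).

Lemma sub_pre f W (L1 L2 : {set T}) : L1 \subset L2 -> pre f W L1 \subset pre f W L2.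
Proof. by move=> /subsetP h; apply/subsetP => x; rewrite !inE => /andP[-> /h]. Qed.

(** The first generation maps into [L], which is disjoint from [W], so its points cannot reappear in
    a later generation and may be removed from [W]. *)
Lemma iter_pre_restrict f W L t : [disjoint L & W] ->
  iter t (pre f W) (pre f W L) \subset iter t (pre f (W :\: pre f W L)) (pre f W L).
Proof.
move=> dLW; suff: iter t (pre f W) (pre f W L) \subset W /\
    iter t (pre f W) (pre f W L) \subset iter t (pre f (W :\: pre f W L)) (pre f W L) by case.
elim: t => [|t [IH1 IH2]] /=.
  by split => //; apply/subsetP => x; rewrite inE => /andP[].
split; first by apply/subsetP => x; rewrite inE => /andP[].
apply: (subset_trans _ (sub_pre _ _ IH2)); apply/subsetP => x.
rewrite inE => /andP[xW fx]; rewrite in_set fx andbT in_setD xW andbT in_set xW /=.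
have := subsetP IH1 _ fx; apply: contraTN => fxL.
by rewrite (disjointFr dLW).
Qed.

Let no_ascent t W L : {set {ffun T -> T}} := [set f | iter t (pre f W) L == set0].

(* One generation, revealed vertex by vertex: [L'] collects the vertices of [W] known to map into
   [L], [P] is still undecided, and the rest of [W] is known to avoid [L].  The step is exact since
   [l / v * (1 - s) + (1 - l / v) = 1 - s * l / v]. *)
Lemma no_ascent_split t (Vs L W : {set T}) :
  (forall L' W' V, [disjoint L' & W'] -> L' :|: W' \subset Vs :\: L ->
    (forall x, x \in W' -> V x = Vs :\: L) ->
    (1 - survival R t) ^+ #|L'| * wt R V <= #|fam V :&: no_ascent t W' L'|%:R) ->
  [disjoint L & W] -> L :|: W \subset Vs ->
  forall m P L' V, #|P| = m -> P \subset W -> L' \subset W -> [disjoint P & L'] ->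
    (forall x, x \in P -> V x = Vs) -> (forall x, x \in L' -> V x = L) ->
    (forall x, x \in W :\: (P :|: L') -> V x = Vs :\: L) ->
  (1 - survival R t) ^+ #|L'| * (1 - survival R t * #|L|%:R / #|Vs|%:R) ^+ m * wt R V
    <= #|fam V :&: no_ascent t.+1 W L|%:R.
Proof.
move=> IH dLW LWV; have /andP[LV WV] : (L \subset Vs) && (W \subset Vs) by rewrite -subUset.
elim=> [|m IHm] P L' V cP PW L'W dPL' VP VL' VW'.
  move/eqP: cP; rewrite cards_eq0 => /eqP P0; rewrite P0 set0U in VW'.
  rewrite expr0 mulr1; apply: le_trans (IH L' (W :\: L') V _ _ _) _.
  - by apply/pred0P => z /=; rewrite !inE; case: (z \in L').
  - have WVL : W \subset Vs :\: L by rewrite subsetD WV disjoint_sym.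
    by rewrite subUset (subset_trans L'W) //= (subset_trans (subsetDl _ _)).
  - exact: VW'.
  rewrite ler_nat subset_leq_card //; apply/subsetP => f /setIP[fV].
  rewrite in_setI fV !inE /= => /eqP f0; rewrite -iterS iterSr -subset0.
  (* Every vertex of [W] is decided by now, so [L'] is the whole first generation. *)
  have E : pre f W L = L'.
    apply/setP => x; rewrite inE; case: (boolP (x \in L')) => xL'.
      by rewrite (subsetP L'W) //= -(VL' x xL') (famP _ _ fV).
    case: (boolP (x \in W)) => //= xW; apply/negbTE.
    have := famP _ _ fV x; rewrite VW'; last by rewrite in_setD xL'.
    by rewrite in_setD => /andP[].
  by rewrite -f0 -E; exact: iter_pre_restrict.
have [x xP] : {x | x \in P} by apply/sigW/card_gt0P; rewrite cP.
have xW := subsetP PW x xP; have xV := subsetP WV x xW.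
have xL' : x \notin L' by rewrite (disjointFr dPL').
have V0 : #|Vs|%:R != 0 :> R by rewrite pnatr_eq0 -lt0n; apply/card_gt0P; exists x.
rewrite (fam_split V x L) natrD (VP x xP) (setIidPr LV).
have cP' : #|P :\ x| = m by move: cP; rewrite (cardsD1 x) xP => -[].
have subP' : P :\ x \subset W by apply: subset_trans PW; exact: subD1set.
have neqP z : z \in P :\ x -> z != x by rewrite !inE => /andP[].
have PinP z : z \in P :\ x -> z \in P by rewrite !inE => /andP[].
have h1 : (1 - survival R t) ^+ #|x |: L'| * (1 - survival R t * #|L|%:R / #|Vs|%:R) ^+ m
    * wt R (upd V x L) <= #|fam (upd V x L) :&: no_ascent t.+1 W L|%:R.
  apply: (IHm (P :\ x)) => //.
  - by rewrite subUset sub1set xW.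
  - apply/pred0P => z /=; rewrite !inE; case: (z =P x) => //= _.
    by case zP: (z \in P) => //=; rewrite (disjointFr dPL' zP).
  - by move=> z zP; rewrite upd_other ?VP ?neqP // PinP.
  - move=> z /setU1P[->|zL']; first by rewrite upd_same.
    by rewrite upd_other ?VL' //; apply: contraNneq xL' => <-.
  - move=> z; rewrite !inE !negb_or negb_and negbK => /andP[/andP[h1 /andP[zx zL']] zW].
    rewrite upd_other // VW' // !inE negb_or zW zL' !andbT.
    by move: h1; rewrite (negbTE zx).
have h2 : (1 - survival R t) ^+ #|L'| * (1 - survival R t * #|L|%:R / #|Vs|%:R) ^+ m
    * wt R (upd V x (Vs :\: L)) <= #|fam (upd V x (Vs :\: L)) :&: no_ascent t.+1 W L|%:R.
  apply: (IHm (P :\ x)) => //.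
  - by apply: disjointWl dPL'; apply/subsetP => z /PinP.
  - by move=> z zP; rewrite upd_other ?VP ?neqP // PinP.
  - move=> z zL'; rewrite upd_other ?VL' //; apply: contraNneq xL' => <-//.
  - move=> z; rewrite /upd; case: eqP => // /eqP zx; rewrite !inE (negbTE zx) /= => zW.
    by rewrite VW' // !inE.
apply: le_trans (lerD h1 h2); rewrite !wt_upd (wtE _ _ x) (VP x xP).
rewrite cardsU1 xL' add1n exprS exprSr cardsD (setIidPr LV).
rewrite natrB ?subset_leq_card // le_eqVlt; apply/orP; left; apply/eqP.
by field.
Qed.

(** Passing to the next generation removes [L] from the range [Vs] and turns some vertices of [W]
    into the new [L], so that [L :|: W \subset Vs] persists. This inclusion is the count
    [p + l <= v] required by [binomial_miss]. *)
Lemma no_ascent_bound t : forall (Vs L W : {set T}) V,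
  [disjoint L & W] -> L :|: W \subset Vs -> (forall x, x \in W -> V x = Vs) ->
  (1 - survival R t) ^+ #|L| * wt R V <= #|fam V :&: no_ascent t W L|%:R.
Proof.
elim: t => [|t IH] Vs L W V dLW LWV VW.
  have -> : survival R 0 = 1 by rewrite /survival add0r divff ?pnatr_eq0.
  rewrite subrr; case: (eqVneq L set0) => [->|L0]; last first.
    by rewrite expr0n cards_eq0 (negbTE L0) mul0r.
  rewrite cards0 mul1r -card_fam ler_nat subset_leq_card //.
  by apply/subsetP => f fV; rewrite in_setI fV inE eqxx.
have := @no_ascent_split t Vs L W _ dLW LWV #|W| W set0 V erefl.
rewrite cards0 expr0 mul1r; move=> h; apply: le_trans (h _ _ _ _ _ _ _) => //.
- rewrite ler_wpM2r ?wt_ge0 //.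
  have s01 : 0 <= survival R t <= 1 by rewrite ltW ?survival_gt0 ?survival_le1.
  apply: le_trans (binomial_miss s01 _); last first.
    rewrite addnC; have := subset_leq_card LWV; rewrite cardsU.
    by move: dLW; rewrite -setI_eq0 => /eqP ->; rewrite cards0 subn0.
  by rewrite exprM lerXn2r ?nnegrE ?survivalS ?exprn_ge0 ?subr_ge0 ?survival_le1 //;
    have := survival_le1 R t; have := survival_gt0 R t; lra.
- by move=> L' W' V'; exact: IH.
- exact: sub0set.
- by rewrite -setI_eq0 setI0.
- by move=> x; rewrite inE.
- by move=> x; rewrite setU0 setDv inE.
Qed.
End Heights.

(** * Finite averages *)

Section Mean.
Variables (R : realFieldType) (I : finType).
Implicit Types (F G : I -> R) (P Q : pred I).

Definition mean F : R := (\sum_i F i) / #|I|%:R.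

Definition pr P : R := mean (fun i => (P i)%:R).

Lemma le_mean F G : (forall i, F i <= G i) -> mean F <= mean G.
Proof. by move=> h; rewrite ler_wpM2r ?invr_ge0 // ler_sum. Qed.

Lemma eq_mean F G : F =1 G -> mean F = mean G.
Proof. by move=> h; rewrite /mean (eq_bigr G). Qed.

Lemma mean_ge0 F : (forall i, 0 <= F i) -> 0 <= mean F.
Proof. by move=> h; rewrite divr_ge0 // sumr_ge0. Qed.

Lemma meanD F G : mean (fun i => F i + G i) = mean F + mean G.
Proof. by rewrite /mean big_split mulrDl. Qed.

Lemma meanZ c F : mean (fun i => c * F i) = c * mean F.
Proof. by rewrite /mean -mulr_sumr mulrA. Qed.

Lemma mean_sum (J : finType) (A : pred J) (F : J -> I -> R) :
  mean (fun i => \sum_(j | A j) F j i) = \sum_(j | A j) mean (F j).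
Proof. by rewrite /mean exchange_big mulr_suml. Qed.

Lemma sum_cst (c : R) : \sum_(i : I) c = c * #|I|%:R.
Proof. by rewrite sumr_const mulr_natr. Qed.

Lemma mean_cst c : (0 < #|I|)%N -> mean (fun=> c) = c.
Proof. by move=> I0; rewrite /mean sum_cst mulfK // pnatr_eq0 -lt0n. Qed.

Lemma prE P : pr P = #|P|%:R / #|I|%:R.
Proof.
rewrite /pr /mean -natr_sum -[#|P|]sum1_card [in RHS]big_mkcond /=.
by congr (_%:R / _); apply: eq_bigr => i _; rewrite unfold_in; case: (P i).
Qed.

Lemma sub_pr P Q : (forall i, P i -> Q i) -> pr P <= pr Q.
Proof. by move=> h; apply: le_mean => i; rewrite ler_nat; case: (P i) (h i) => // ->. Qed.

Lemma prU P Q : pr (predU P Q) <= pr P + pr Q.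
Proof.
rewrite /pr -meanD; apply: le_mean => i; rewrite -natrD ler_nat /=.
by case: (P i) (Q i) => [] [].
Qed.

Lemma pr_exists (J : finType) (A : pred J) (P : J -> pred I) :
  pr (fun i => [exists j, A j && P j i]) <= \sum_(j | A j) pr (P j).
Proof.
rewrite /pr -mean_sum; apply: le_mean => i; case: existsP => [[j /andP[Aj Pj]]|_]; last first.
  by rewrite sumr_ge0.
by rewrite (bigD1 j) //= Pj lerDl sumr_ge0.
Qed.

Lemma markov F c : 0 < c -> (forall i, 0 <= F i) -> pr (fun i => c <= F i) <= mean F / c.
Proof.
move=> c0 F0; rewrite ler_pdivlMr // mulrC /pr -meanZ; apply: le_mean => i.
by case: (leP c (F i)) => h /=; rewrite ?mulr1 ?mulr0 ?F0.
Qed.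

Lemma prC P : (0 < #|I|)%N -> pr P = 1 - pr (predC P).
Proof.
move=> I0; apply/esym/eqP; rewrite subr_eq /pr -meanD -[X in X == _](mean_cst 1 I0).
apply/eqP/eq_mean => i /=.
by case: (P i); rewrite ?addr0 ?add0r.
Qed.

End Mean.

(** * Switching arguments: redirecting one edge of a random map *)

Section Switching.
Variable T : finType.
Implicit Types (f : {ffun T -> T}) (E F : {set {ffun T -> T}}).

Definition setf f x y : {ffun T -> T} := [ffun z => if z == x then y else f z].

(* Redirecting [f] at [w f] to [y] loses no information: the new function shows [w f], its value
   there is [y], and the old value was [v f]. *)
Lemma switching E F (w v : {ffun T -> T} -> T) :
  (forall f, f \in E -> f (w f) = v f) ->
  (forall f y, f \in E -> [/\ setf f (w f) y \in F,
     w (setf f (w f) y) = w f & v (setf f (w f) y) = v f]) ->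
  (#|E| * #|T| <= #|F|)%N.
Proof.
move=> Ev EF; pose h (p : {ffun T -> T} * T) := setf p.1 (w p.1) p.2.
rewrite -(cardsT T) -cardsX -(card_in_imset (f := h)); last first.
  move=> [f y] [g z] /setXP[/= fE _] /setXP[/= gE _]; rewrite /h /= => e.
  have [_ wf vf] := EF f y fE; have [_ wg vg] := EF g z gE.
  have wfg : w f = w g by rewrite -wf e wg.
  have vfg : v f = v g by rewrite -vf e vg.
  move/ffunP: e; rewrite wfg => e; congr pair; last first.
    by have := e (w g); rewrite !ffunE eqxx.
  apply/ffunP => x; have := e x; rewrite !ffunE; case: eqP => // -> _.
  by rewrite Ev // -wfg Ev.
apply: subset_leq_card; apply/subsetP => _ /imsetP[[f y] /setXP[/= fE _] ->].
by have [] := EF f y fE.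
Qed.

Lemma iter_setf f u m y k : uniq (traject f u m.+1) -> (k <= m)%N ->
  iter k (setf f (iter m f u) y) u = iter k f u.
Proof.
move=> unq; elim: k => //= k IH km; rewrite IH 1?ltnW // ffunE ifN //.
apply: contraTneq unq => e; apply/(uniqPn u); exists k, m.
by rewrite size_traject !nth_traject // ltnW.
Qed.

(** Whether the path closes at [i] depends only on the edge out of its last vertex, and the target
    of that edge is free. *)
Lemma card_closing u i j : (i < j)%N ->
  (#|[set f : {ffun T -> T} | uniq (traject f u j) && (iter j f u == iter i f u)]| * #|T|
   <= #|{ffun T -> T}|)%N.
Proof.
case: j => // j ij; rewrite -[leqRHS]cardsT.
apply: (switching (w := fun f => iter j f u) (v := fun f => iter i f u)) => [f|f y].
  by rewrite inE => /andP[_ /eqP].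
by rewrite !inE => /andP[unq _]; split => //; rewrite iter_setf.
Qed.

End Switching.

(** * First moments for the images of iterates and for short orbits *)

Section Images.
Variables (R : realType) (T : finType).
Hypothesis T0 : (0 < #|T|)%N.
Implicit Types f : {ffun T -> T}.

Notation FT := {ffun T -> T}.

Lemma card_ffun_gt0 : (0 < #|{: FT}|)%N.
Proof. by rewrite card_ffun expn_gt0 T0. Qed.

Lemma pr_le_inv (E : pred FT) (m : nat) : (0 < m)%N -> (#|E| * m <= #|{: FT}|)%N ->
  pr R E <= m%:R^-1.
Proof.
move=> m0 h; rewrite prE ler_pdivrMr ?ltr0n ?card_ffun_gt0 // mulrC.
by rewrite ler_pdivlMr ?ltr0n // -natrM ler_nat.
Qed.

Lemma pr_closing u i j : (i < j)%N ->
  pr R (fun f : FT => uniq (traject f u j) && (iter j f u == iter i f u)) <= #|T|%:R^-1.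
Proof.
move=> ij; apply: pr_le_inv => //; apply: leq_trans (card_closing u ij).
by rewrite leq_mul2r subset_leq_card ?orbT //; apply/subsetP => f; rewrite inE.
Qed.

Definition periodic f u t := [exists m : 'I_t, iter m.+1 f u == u].

(** At the first return to [u] the orbit closes without earlier repetition: a repetition at times
    [i < j] could be cut out, giving a return [j - i] steps sooner. *)
Lemma pr_periodic u t : pr R (fun f => periodic f u t) <= t%:R / #|T|%:R.
Proof.
pose E (j : 'I_t) f := uniq (traject f u j.+1) && (iter j.+1 f u == iter 0 f u).
apply: (@le_trans _ _ (pr R (fun f => [exists j : 'I_t, true && E j f]))).
  apply: sub_pr => f /existsP[m0 em0].
  have ex : exists m, (m < t)%N && (iter m.+1 f u == u) by exists m0; rewrite ltn_ord.
  case: (ex_minnP ex) => m /andP[mt em] min; apply/existsP; exists (Ordinal mt).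
  rewrite /E [iter 0 f u]/iter (eqP em) eqxx andbT; apply: contraT => /(uniqPn u) [i [j [ij]]].
  rewrite size_traject => jm; rewrite !nth_traject ?(ltn_trans ij) // => e; rewrite /= in jm.
  have := min (m - (j - i))%N; rewrite -subSn; last by lia.
  suff -> : iter (m.+1 - (j - i)) f u == u by rewrite andbT; lia.
  have -> : (m.+1 - (j - i))%N = (m.+1 - j + i)%N by lia.
  by rewrite iterD e -iterD subnK //; lia.
apply: le_trans (pr_exists _ _ _) _.
rewrite -[in t%:R](card_ord t) -sum1_card natr_sum mulr_suml; apply: ler_sum => j _.
by rewrite mul1r; exact: pr_closing.
Qed.

Definition img f t : {set T} := [set iter t f x | x : T].

(** Follow a path of length [t] ending in [y]. If it meets [y] only at its end, it is a branch of
    the backward tree of [y] that avoids [y]; otherwise [y] lies on a cycle of length at most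
    [t]. *)
Lemma img_ascent f t y : y \in img f t ->
  (iter t (pre f (~: [set y])) [set y] != set0) || periodic f y t.
Proof.
move=> /imsetP[x _ ex]; case: (boolP (periodic f y t)) => [|np]; rewrite ?orbT // orbF.
apply/set0Pn; exists x.
have ne k : (k < t)%N -> iter k f x != y.
  move=> kt; apply: contra np => /eqP e.
  have h : (t - k.+1 < t)%N by lia.
  apply/existsP; exists (Ordinal h); rewrite -[X in iter _ f X]e -iterD; apply/eqP.
  by rewrite [in RHS]ex; congr (iter _ f x); rewrite /=; lia.
suff: forall k, (k <= t)%N -> iter (t - k) f x \in iter k (pre f (~: [set y])) [set y].
  by move/(_ t (leqnn t)); rewrite subnn.
elim=> [|k IH] kt /=; first by rewrite subn0 -ex inE.
have h : (t - k.+1 < t)%N by lia.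
rewrite in_set in_setC in_set1 (ne _ h) /=.
by rewrite -iterS subnSK // IH // ltnW.
Qed.

Lemma pr_ascent t y :
  pr R (fun f => iter t (pre f (~: [set y])) [set y] != set0) <= survival R t.
Proof.
rewrite (prC _ _ card_ffun_gt0) lerBlDl -lerBlDr.
have := @no_ascent_bound R T t setT [set y] (~: [set y]) (fun _ => setT).
rewrite cards1 expr1 -card_fam => h.
have F : fam (fun _ : T => [set: T]) = setT.
  by apply/setP => f; rewrite in_setT; apply/famP => x; rewrite in_setT.
rewrite prE ler_pdivlMr ?ltr0n ?card_ffun_gt0 //.
rewrite F setTI cardsT in h; apply: le_trans (h _ _ _) _ => //.
  by apply/pred0P => x /=; rewrite !inE; case: eqP.
by rewrite ler_nat subset_leq_card //; apply/subsetP => f; rewrite !inE negbK.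
Qed.

(** Linearity over the points of the image. For [t ~ sqrt n] both terms have order [sqrt n]. *)
Lemma mean_img t : mean (fun f => #|img f t|%:R) <= survival R t * #|T|%:R + t%:R.
Proof.
have -> : mean (fun f => #|img f t|%:R) = \sum_y pr R (fun f => y \in img f t).
  by rewrite -mean_sum; apply: eq_mean => f; rewrite -sum1_card big_mkcond /= natr_sum;
    apply: eq_bigr => y _; case: (_ \in _).
apply: (@le_trans _ _ (\sum_(y : T) (survival R t + t%:R / #|T|%:R))); last first.
  by rewrite sum_cst mulrDl mulfVK // pnatr_eq0 -lt0n.
apply: ler_sum => y _; apply: le_trans (lerD (pr_ascent t y) (pr_periodic y t)).
apply: le_trans (prU _ _ _); apply: sub_pr => f; exact: img_ascent.
Qed.

Definition short_orbit f m : {set T} := [set u | ~~ uniq (traject f u m)].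

(** A repetition among the first [m] points has a first closing time [j] and a target [i < j]: at
    most [m ^ 2] choices, each of probability at most [1 / n]. *)
Lemma mean_short_orbit m : mean (fun f => #|short_orbit f m|%:R) <= m%:R ^+ 2 :> R.
Proof.
have -> : mean (fun f => #|short_orbit f m|%:R)
    = \sum_u pr R (fun f => ~~ uniq (traject f u m)).
  rewrite -mean_sum; apply: eq_mean => f; rewrite -sum1_card big_mkcond /= natr_sum.
  by apply: eq_bigr => y _; rewrite inE; case: uniq.
apply: (@le_trans _ _ (\sum_(u : T) (m%:R ^+ 2 / #|T|%:R))); last first.
  by rewrite sum_cst mulfVK // pnatr_eq0 -lt0n.
apply: ler_sum => u _.
pose E (p : 'I_m * 'I_m) f := uniq (traject f u p.2) && (iter p.2 f u == iter p.1 f u).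
have closes f : ~~ uniq (traject f u m) -> [exists p : 'I_m * 'I_m, (p.1 < p.2)%N && E p f].
  rewrite /E {E}; elim: m => // k IH.
  have widen : [exists p : 'I_k * 'I_k, (p.1 < p.2)%N &&
      (uniq (traject f u p.2) && (iter p.2 f u == iter p.1 f u))] ->
    [exists p : 'I_k.+1 * 'I_k.+1, (p.1 < p.2)%N &&
      (uniq (traject f u p.2) && (iter p.2 f u == iter p.1 f u))].
    move=> /existsP[[i j] h]; apply/existsP.
    by exists (widen_ord (leqnSn k) i, widen_ord (leqnSn k) j).
  rewrite trajectSr rcons_uniq negb_and negbK => /orP[|/IH/widen //].
  case: (boolP (uniq (traject f u k))) => [unq|/IH/widen //].
  move=> /trajectP[i ik e]; apply/existsP.
  by exists (Ordinal (ltnW ik : i < k.+1)%N, ord_max); rewrite /= ik unq e eqxx.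
apply: (le_trans (sub_pr R closes)).
apply: le_trans (pr_exists _ _ _) _.
apply: (@le_trans _ _ (\sum_(p : 'I_m * 'I_m) #|T|%:R^-1)).
  rewrite big_mkcond /=; apply: ler_sum => p _; case: ifP => [ij|_]; first exact: pr_closing.
  by rewrite invr_ge0.
by rewrite sum_cst card_prod card_ord natrM expr2 mulrC.
Qed.

End Images.

(** * Collisions *)

Section Collisions.
Variable T : finType.

(** Ordered pairs, the diagonal included, so that this is the sum of the squared fibre sizes of
    [g]. *)
Definition collisions (g : T -> T) : nat := #|[set p : T * T | g p.1 == g p.2]|.

Lemma sum_sqr_le (I : finType) (A : {set I}) (d : I -> nat) :
  ((\sum_(i in A) d i) ^ 2 <= #|A| * \sum_(i in A) d i ^ 2)%N.
Proof.
rewrite -mulnn big_distrlr /= -(leq_pmul2l (isT : 0 < 2)%N).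
apply: (@leq_trans (\sum_(i in A) \sum_(j in A) (d i ^ 2 + d j ^ 2))%N).
  rewrite big_distrr; apply: leq_sum => i _; rewrite big_distrr; apply: leq_sum => j _ /=.
  by have [] := nat_Cauchy (d i) (d j).
under eq_bigr => i _ do rewrite big_split /= sum_nat_const.
by rewrite big_split /= sum_nat_const -big_distrr /= addnn -mul2n.
Qed.

(** Cauchy-Schwarz over the fibres above [S]. *)
Lemma preim_sqr_le (g : T -> T) (S : {set T}) :
  (#|[set x | g x \in S]| ^ 2 <= #|S| * collisions g)%N.
Proof.
pose d y := #|[set x | g x == y]|.
have -> : #|[set x | g x \in S]| = (\sum_(y in S) d y)%N.
  rewrite -sum1_card (partition_big g (mem S)) /=; last by move=> x; rewrite inE.
  apply: eq_bigr => y yS; rewrite /d -sum1_card; apply: eq_bigl => x.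
  by rewrite !inE; case: eqP => [->|]; rewrite ?yS ?andbF.
apply: leq_trans (sum_sqr_le _ _) _; rewrite leq_mul2l; apply/orP; right.
rewrite /collisions -sum1_card.
rewrite (partition_big (fun p : T * T => g p.1) predT) //=.
rewrite [leqRHS](bigID (mem S)) /= -[leqLHS]addn0 leq_add //.
apply: leq_sum => y _; rewrite sum1_card -mulnn -cardsX.
rewrite subset_leq_card //; apply/subsetP => -[x x'].
by rewrite !inE /= => /andP[/eqP gx /eqP gx']; rewrite unfold_in /= !inE /= gx gx' !eqxx.
Qed.

(** In other words, [g] identifies two uniform states with probability at least the inverse of the
    size of its image. This is how a leaf gets merged. *)
Lemma collisions_img (g : T -> T) : (#|T| ^ 2 <= #|[set g x | x : T]| * collisions g)%N.
Proof.
have := preim_sqr_le g [set g x | x : T].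
suff -> : [set x | g x \in [set g x | x : T]] = setT by rewrite cardsT.
by apply/setP => x; rewrite !inE imset_f.
Qed.

End Collisions.

(** * Second moment of the number of collisions of a random map *)

Section Variance.
Variables (R : realType) (T : finType).
Hypothesis T0 : (0 < #|T|)%N.
Notation FT := {ffun T -> T}.
Notation n := (#|T|%:R : R).

Let n0 : 0 < n. Proof. by rewrite ltr0n. Qed.

Definition hit (p : T * T) (f : FT) := f p.1 == f p.2.

(** One inequality is a switching at [x]; for the other, a map is encoded by copying the value at
    [x'] to [x] and remembering the value that was overwritten. *)
Lemma card_hit (p : T * T) : p.1 != p.2 -> (#|[set f | hit p f]| * #|T| = #|{: FT}|)%N.
Proof.
case: p => x x' /= xx'; apply/eqP; rewrite eqn_leq; apply/andP; split.
  rewrite -[leqRHS]cardsT.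
  apply: (switching (w := fun=> x) (v := fun f => f x')) => [f|f y].
    by rewrite inE => /eqP.
  by rewrite !inE /= ffunE [x' == x]eq_sym (negbTE xx').
rewrite -(cardsT T) -cardsX.
pose h (g : FT) := (setf g x (g x'), g x).
have hi : injective h.
  move=> g1 g2 [/ffunP e1 e2]; apply/ffunP => z; have := e1 z; rewrite !ffunE.
  by case: eqP => [->|].
rewrite -[leqLHS]cardsT -(card_imset _ hi) subset_leq_card //.
apply/subsetP => _ /imsetP[g _ ->]; rewrite !inE /hit /= !ffunE eqxx andbT.
by rewrite [x' == x]eq_sym (negbTE xx').
Qed.

(** As unordered pairs [p] and [q] differ, so [q] has an endpoint outside of [p]; redirecting the
    map there does not affect [hit p]. *)
Lemma card_hit2 (p q : T * T) : p.1 != p.2 -> q.1 != q.2 ->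
  q != p -> q != (p.2, p.1) ->
  (#|[set f | hit p f && hit q f]| * #|T| <= #|[set f | hit p f]|)%N.
Proof.
case: p q => x x' [w w'] /= xx' ww' qp qp'.
have [[w1 w2]|[w1 w2]] : (w != x /\ w != x') \/ (w' != x /\ w' != x').
  case: (w =P x) => [e|]; case: (w =P x') => [e'|]; auto.
  - by move: xx'; rewrite -e -e' eqxx.
  - right; split; first by rewrite -e eq_sym.
    by apply: contraNneq qp => <-; rewrite e.
  - right; split; last by rewrite -e' eq_sym.
    by apply: contraNneq qp' => <-; rewrite e'.
- apply: (switching (w := fun=> w) (v := fun f => f w')) => [f|f y].
    by rewrite inE => /andP[_ /eqP].
  rewrite !inE /hit /= !ffunE => /andP[e _].
  by rewrite [x == w]eq_sym (negbTE w1) [x' == w]eq_sym (negbTE w2) [w' == w]eq_sym (negbTE ww') e.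
- apply: (switching (w := fun=> w') (v := fun f => f w)) => [f|f y].
    by rewrite inE => /andP[_ /eqP].
  rewrite !inE /hit /= !ffunE => /andP[e _].
  by rewrite [x == w']eq_sym (negbTE w1) [x' == w']eq_sym (negbTE w2) (negbTE ww') e.
Qed.

Definition offdiag : pred (T * T) := fun p => p.1 != p.2.
Definition off_hits (f : FT) : R := \sum_(p | offdiag p) (hit p f)%:R.

Lemma pr_hit p : offdiag p -> pr R (hit p) = n^-1.
Proof.
move=> pd; have e := card_hit pd; rewrite prE -e natrM.
have -> : #|hit p| = #|[set f | hit p f]| by apply: eq_card => f; rewrite inE.
have : (0 < #|[set f | hit p f]|)%N.
  by rewrite lt0n; apply: contraTneq (card_ffun_gt0 T0) => h; rewrite -e h.
rewrite -(ltr0n R) => h; rewrite invfM mulrA divff ?mul1r //; exact: lt0r_neq0.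
Qed.

Lemma pr_hit2 p q : offdiag p -> offdiag q ->
  pr R (fun f => hit p f && hit q f)
    <= n^-1 ^+ 2 + ((q == p)%:R + (q == (p.2, p.1))%:R) * n^-1.
Proof.
move=> pd qd; have [->|qp] := eqVneq q p.
  apply: (@le_trans _ _ (pr R (hit p))); first by apply: sub_pr => f /andP[].
  rewrite pr_hit // mulrDl mul1r -[leLHS]add0r lerD ?exprn_ge0 ?invr_ge0 //.
  by rewrite lerDl mulr_ge0 ?invr_ge0.
have [->|qp'] := eqVneq q (p.2, p.1).
  apply: (@le_trans _ _ (pr R (hit p))); first by apply: sub_pr => f /andP[].
  by rewrite pr_hit // add0r mul1r -[leLHS]add0r lerD ?exprn_ge0 ?invr_ge0.
rewrite addr0 mul0r addr0 expr2 -[X in X * _](pr_hit pd) !prE.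
rewrite mulrAC ler_pM2r ?invr_gt0 ?ltr0n ?card_ffun_gt0 //.
rewrite ler_pdivlMr // -natrM ler_nat.
have := card_hit2 pd qd qp qp'.
by congr (_ * _ <= _)%N; apply: eq_card => f; rewrite inE.
Qed.

(** The events [hit p] are pairwise independent, except that a pair and its reversal give the same
    event. Hence the variance is at most twice the mean. *)
Lemma off_hits_variance : mean (fun f => (off_hits f - #|offdiag|%:R / n) ^+ 2) <= 2 * n.
Proof.
set m := #|offdiag|%:R / n.
have m2 : #|offdiag|%:R <= n ^+ 2.
  rewrite -natrX ler_nat (leq_trans (max_card _)) // card_prod -mulnn //.
have m1 : mean off_hits = m.
  rewrite /off_hits mean_sum (eq_bigr (fun=> n^-1)) => [|p pd]; last exact: pr_hit.
  by rewrite sumr_const /m mulr_natl.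
have s2 : mean (fun f => off_hits f ^+ 2) <= m ^+ 2 + 2 * m.
  have -> : mean (fun f => off_hits f ^+ 2) =
     \sum_(p | offdiag p) \sum_(q | offdiag q) pr R (fun f => hit p f && hit q f).
    rewrite (eq_mean (G := fun f => \sum_(p | offdiag p) \sum_(q | offdiag q)
        (hit p f && hit q f)%:R)); last first.
      move=> f; rewrite expr2 /off_hits big_distrlr /=.
      by apply: eq_bigr => p _; apply: eq_bigr => q _; rewrite -natrM mulnb.
    by rewrite mean_sum; apply: eq_bigr => p _; rewrite mean_sum.
  apply: (@le_trans _ _ (\sum_(p | offdiag p) (#|offdiag|%:R * n^-1 ^+ 2 + 2 * n^-1))).
    apply: ler_sum => p pd.
    apply: (@le_trans _ _ (\sum_(q | offdiag q)
        (n^-1 ^+ 2 + ((q == p)%:R + (q == (p.2, p.1))%:R) * n^-1))).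
      by apply: ler_sum => q qd; exact: pr_hit2.
    rewrite big_split /= sumr_const mulr_natl lerD2l.
    rewrite -mulr_suml ler_wpM2r ?invr_ge0 // big_split /= -[leRHS]/(1 + 1) lerD //.
      by rewrite -natr_sum -[1]/(1%:R) ler_nat -big_mkcondr /= sum1_card
        -(card1 p) subset_leq_card //; apply/subsetP => q; rewrite !inE unfold_in => /andP[].
    by rewrite -natr_sum -[1]/(1%:R) ler_nat -big_mkcondr /= sum1_card
        -(card1 (p.2, p.1)) subset_leq_card //; apply/subsetP => q; rewrite !inE unfold_in => /andP[].
  rewrite sumr_const -[leLHS]mulr_natl mulrDr le_eqVlt; apply/orP; left; apply/eqP.
  by rewrite /m; field; rewrite lt0r_neq0.
have -> : mean (fun f => (off_hits f - m) ^+ 2)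
    = mean (fun f => off_hits f ^+ 2) + (- (2 * m)) * mean off_hits + m ^+ 2.
  rewrite -(mean_cst (m ^+ 2) (card_ffun_gt0 T0)) -meanZ -!meanD; apply: eq_mean => f.
  by rewrite sqrrB; ring.
have mn : m <= n by rewrite /m ler_pdivrMr // -expr2.
rewrite m1; lra.
Qed.

Lemma collisionsE (f : FT) : (collisions f)%:R = off_hits f + n.
Proof.
rewrite /collisions -sum1_card natr_sum (bigID offdiag) /=; congr (_ + _).
  rewrite /off_hits [LHS]big_mkcond [RHS]big_mkcond /=; apply: eq_bigr => p _.
  by rewrite inE /hit; case: (offdiag p); case: eqP.
rewrite -natr_sum sum1_card; congr _%:R.
have diag_inj : injective (fun x : T => (x, x)) by move=> x y [].
rewrite -[RHS]cardsT -(card_imset _ diag_inj).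
apply: eq_card => -[x y]; rewrite unfold_in /= inE negbK; apply/andP/imsetP => [[_ /eqP/= ->]|[z _ [-> ->]]].
  by exists y.
by rewrite !eqxx.
Qed.

(** Chebyshev's inequality: the diagonal contributes [n] and the mean of the rest is at most [n], so
    that [3 n] is a deviation of at least [n]. *)
Lemma pr_collisions : pr R (fun f : FT => (3 * #|T| <= collisions f)%N) <= 2 / n.
Proof.
have n2 : 0 < n ^+ 2 by rewrite exprn_gt0.
apply: (@le_trans _ _ (pr R (fun f => n ^+ 2 <= (off_hits f - #|offdiag|%:R / n) ^+ 2))); last first.
  apply: le_trans (markov n2 _) _ => [f|]; first exact: sqr_ge0.
  rewrite ler_pdivrMr //; apply: le_trans off_hits_variance _.
  by rewrite expr2 mulrA divfK ?lt0r_neq0.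
apply: sub_pr => f; rewrite -(ler_nat R) collisionsE natrM => h.
have dn : #|offdiag|%:R / n <= n.
  by rewrite ler_pdivrMr // -expr2 -natrX ler_nat (leq_trans (max_card _)) // card_prod -mulnn.
by rewrite lerXn2r ?nnegrE ?(ltW n0) //;
  have := n0; move: h dn; set a := off_hits f; set b := _ / _; lra.
Qed.

End Variance.

(** * Merging a pair of states *)

Section Merging.
Variable T : finType.
Implicit Types a b : T -> T.

Definition run a b (w : seq bool) (x : T) : T :=
  foldl (fun y c => if c then b y else a y) x w.

Fixpoint mergeable a b (l : nat) (x y : T) : bool :=
  (x == y) || (if l is l'.+1
               then mergeable a b l' (a x) (a y) || mergeable a b l' (b x) (b y)
               else false).

Lemma mergeable_word a b l x y : mergeable a b l x y ->
  exists2 w, (size w <= l)%N & run a b w x = run a b w y.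
Proof.
elim: l x y => [|l IH] x y /=; first by rewrite orbF => /eqP ->; exists [::].
case/or3P => [/eqP ->|/IH[w wl e]|/IH[w wl e]]; first by exists [::].
- by exists (false :: w).
- by exists (true :: w).
Qed.

Lemma mergeable_a a b l x y : mergeable a b l (a x) (a y) -> mergeable a b l.+1 x y.
Proof. by move=> /= ->; rewrite orbT. Qed.

Lemma mergeable_b a b l x y : mergeable a b l (b x) (b y) -> mergeable a b l.+1 x y.
Proof. by move=> /= ->; rewrite !orbT. Qed.

Lemma mergeable_iter_a a b i l x y :
  mergeable a b l (iter i a x) (iter i a y) -> mergeable a b (i + l) x y.
Proof. by elim: i l => // i IH l /mergeable_a /IH; rewrite addnS. Qed.

Lemma mergeable_iter_b a b i l x y :
  mergeable a b l (iter i b x) (iter i b y) -> mergeable a b (i + l) x y.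
Proof. by elim: i l => // i IH l /mergeable_b /IH; rewrite addnS. Qed.

Lemma mergeable_leq a b l l' x y : (l <= l')%N -> mergeable a b l x y -> mergeable a b l' x y.
Proof.
elim: l l' x y => [|l IH] [|l'] x y //= ll'; first by rewrite orbF => ->.
by case/or3P => [->//|/(IH l' _ _ ll') ->|/(IH l' _ _ ll') ->]; rewrite !orbT.
Qed.

Lemma mergeable_refl a b l x : mergeable a b l x x.
Proof. by case: l => [|l] /=; rewrite eqxx. Qed.

End Merging.

(** * Recursion for the success probability along the exploration tree *)

Section Rates.
Variable R : realFieldType.

(* In the exploration tree, [kill e] bounds the probability that a node at height [e.+1] has no
   children, and [rate rho e] is a lower bound for the probability that the tree below a node at
   height [e] contains a merging word, where a leaf merges with probability at least [1 / rho]. *)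
Definition kill (e : nat) : R := (3 / 4) ^+ e / 8.

Definition survive (e : nat) : R := \prod_(i < e) (1 - kill i).

Definition rate (rho : R) (e : nat) : R := survive e / (rho / 2 ^+ e + 1).

Lemma kill_gt0 e : 0 < kill e.
Proof. by rewrite divr_gt0 ?exprn_gt0 //; lra. Qed.

Lemma kill_le e : kill e <= 1 / 8.
Proof. by rewrite ler_wpM2r ?exprn_ile1 //; lra. Qed.

(** The numbers [kill i] sum to [1 / 2]; the decaying extra term accounts for those still to come
    and makes the induction close. *)
Lemma survive_ge e : 1 / 2 + (3 / 4) ^+ e / 2 <= survive e.
Proof.
elim: e => [|e IH]; first by rewrite /survive big_ord0 expr0; lra.
rewrite /survive big_ord_recr /= -/(survive e).
have k8 := kill_le e; apply: le_trans (ler_wpM2r _ IH); last by lra.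
rewrite /kill exprSr; set x := (3 / 4) ^+ e.
have x0 : 0 <= x by rewrite exprn_ge0 //; lra.
have x1 : x <= 1 by rewrite exprn_ile1 //; lra.
nra.
Qed.

Lemma survive_bounds e : 1 / 2 <= survive e <= 1.
Proof.
apply/andP; split.
  apply: le_trans (survive_ge e); rewrite lerDl divr_ge0 ?exprn_ge0 //; lra.
rewrite /survive prodr_ile1 // => i _; have := kill_gt0 i; have := kill_le i; lra.
Qed.

(** A node fails if it is killed or if both children fail. With success [1 / x] for a child, a
    surviving node succeeds with probability [2 / x - 1 / x ^ 2 >= 2 / (x + 1)] for [x >= 1], and
    [x = rho / 2 ^ e + 1] becomes [(x + 1) / 2] at the next height. *)
Lemma rate_step (rho : R) e : 0 <= rho ->
  kill e + (1 - kill e) * (1 - rate rho e) ^+ 2 <= 1 - rate rho e.+1.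
Proof.
move=> r0; rewrite /rate /survive big_ord_recr /= -/(survive e).
have /andP[P0 P1] := survive_bounds e; set P := survive e in P0 P1 *.
have k0 := kill_gt0 e; have k8 := kill_le e; set k := kill e in k0 k8 *.
have y0 : 0 <= rho / 2 ^+ e by rewrite divr_ge0 ?exprn_ge0.
have -> : rho / 2 ^+ e.+1 + 1 = (rho / 2 ^+ e + 1 + 1) / 2.
  by rewrite exprSr invfM mulrA; lra.
set x := rho / 2 ^+ e + 1; have x1 : 1 <= x by rewrite /x; lra.
have -> : P * (1 - k) / ((x + 1) / 2) = (1 - k) * (2 * P / (x + 1)) by field; lra.
suff : 2 * P / (x + 1) <= 2 * (P / x) - (P / x) ^+ 2 by nra.
have -> : 2 * (P / x) - (P / x) ^+ 2 = P * (2 * x - P) / x ^+ 2 by field; lra.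
rewrite ler_pdivrMr; last by lra.
rewrite mulrAC ler_pdivlMr; last by rewrite exprn_gt0 //; lra.
rewrite [2 * P]mulrC -!mulrA ler_wpM2l; [nra|lra|nra].
Qed.

Lemma rate_bounds (rho : R) e : 0 <= rho -> 0 <= rate rho e <= 1.
Proof.
move=> r0; have /andP[P0 P1] := survive_bounds e.
have y0 : 0 <= rho / 2 ^+ e by rewrite divr_ge0 ?exprn_ge0.
by rewrite /rate divr_ge0 ?ler_pdivrMr /=; lra.
Qed.

Lemma rate_ge (rho : R) e : 0 <= rho <= 2 ^+ e -> 1 / 4 <= rate rho e.
Proof.
move=> /andP[r0 r1]; have /andP[P0 P1] := survive_bounds e.
have y1 : rho / 2 ^+ e <= 1 by rewrite ler_pdivrMr ?exprn_gt0 // mul1r.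
have y0 : 0 <= rho / 2 ^+ e by rewrite divr_ge0 ?exprn_ge0.
by rewrite /rate ler_pdivlMr; lra.
Qed.

End Rates.

(** * Arithmetic of the size constraints of the exploration *)

Section Budgets.
Local Open Scope nat_scope.

Lemma weaken_budget (x y P m : nat) : x <= y -> y * P <= m -> x * P <= m.
Proof. by move=> xy; apply: leq_trans; rewrite leq_mul2r xy orbT. Qed.

Lemma occupied_budget (o o' q P m : nat) : o' <= o + 4 ->
  (o + 4 * q.+1) * P <= m -> (o' + 4 * q) * P <= m.
Proof. by move=> h; apply: weaken_budget; lia. Qed.

Lemma queue_budget (q q' i P m : nat) : i <= 2 ->
  (2 * q.+1 + q') * P <= m -> (2 * q + (i + q')) * P <= m.
Proof. by move=> h; apply: weaken_budget; lia. Qed.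

Lemma touching_budget (o o' q P M m : nat) : o' <= o + 2 ->
  (o + 4 * q.+1) * P <= 8 * M -> 1024 * (8 * M) <= m -> 1024 * P * o' <= m.
Proof.
move=> h h1 h2; have : o' * P <= 8 * M by apply: weaken_budget h1; lia.
by rewrite -mulnA [P * _]mulnC; lia.
Qed.

Lemma halve_budget (x y P M : nat) : x * (2 * P) <= 2 * y * M -> x * P <= y * M.
Proof. by rewrite mulnCA -mulnA leq_mul2l. Qed.

Lemma start_budget (o q P M : nat) : o * P <= 4 * M -> q * P <= M ->
  (o + 4 * q) * P <= 8 * M.
Proof. by move=> h1 h2; rewrite mulnDl -mulnA; lia. Qed.

End Budgets.

(** * Exploring [b] along binary trees rooted at several pairs *)

Section Exploration.
Variables (R : realType) (T : finType) (a : {ffun T -> T}) (s M : nat) (rho : R).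
Implicit Types (V : T -> {set T}) (b : {ffun T -> T}) (Q : seq (T * T)) (O : {set T}).
Notation n := (#|T|%:R : R).
Hypothesis T0 : (0 < #|T|)%N.
Hypothesis rho0 : 0 < rho.
Hypothesis a_merges : n ^+ 2 <= rho * (collisions (iter s a))%:R.
Hypothesis a_collisions : (collisions a <= 3 * #|T|)%N.
Hypothesis M_small : (1024 * (8 * M) <= #|T|)%N.

Let n0 : 0 < n. Proof. by rewrite ltr0n. Qed.

Definition points Q : seq T := flatten [seq [:: p.1; p.2] | p <- Q].

(** An edge of the tree reads [b] or [b a], hence at most two letters per level; [b a^s] at a leaf
    accounts for [s.+1]. *)
Definition stuck e Q b : bool := all (fun p => ~~ mergeable a b (2 * e + s.+1) p.1 p.2) Q.

Arguments stuck : simpl never.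
Arguments mergeable : simpl never.

Lemma stuck_cons e p Q b :
  stuck e (p :: Q) b = ~~ mergeable a b (2 * e + s.+1) p.1 p.2 && stuck e Q b.
Proof. by []. Qed.

Lemma fam_reveal2 V z z' (E : {set {ffun T -> T}}) : z' != z -> V z = setT -> V z' = setT ->
  (#|fam V :&: E| = \sum_(p : T * T) #|fam (upd (upd V z [set p.1]) z' [set p.2]) :&: E|)%N.
Proof.
move=> zz' Vz Vz'; rewrite (fam_reveal V z) Vz -(pair_bigA _ (fun y y' =>
  #|fam (upd (upd V z [set y]) z' [set y']) :&: E|)) /=.
rewrite big_mkcond; apply: eq_bigr => y _; rewrite inE (fam_reveal _ z').
by rewrite upd_other // Vz' big_mkcond; apply: eq_bigr => y' _; rewrite inE.
Qed.

Lemma wt_upd2 V z z' p : z' != z -> V z = setT -> V z' = setT ->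
  wt R (upd (upd V z [set p.1]) z' [set p.2]) * n ^+ 2 = wt R V :> R.
Proof.
move=> zz' Vz Vz'; rewrite wt_upd cards1 mul1r.
have e1 : wt R (upd V z [set p.1]) = n * wt_rest R (upd V z [set p.1]) z'.
  by rewrite (wtE _ _ z') upd_other // Vz' cardsT.
have e2 : wt R V = n * wt R (upd V z [set p.1]).
  by rewrite (wtE _ _ z) Vz cardsT wt_upd cards1 mul1r.
by rewrite e2 e1; ring.
Qed.

Lemma fam_upd2 V z z' y y' b : z' != z -> V z = setT -> V z' = setT ->
  b \in fam (upd (upd V z [set y]) z' [set y']) -> b z = y /\ b z' = y'.
Proof.
move=> zz' Vz Vz' /famP h; have := h z; have := h z'.
by rewrite upd_same upd_other 1?eq_sym // upd_same !inE => /eqP -> /eqP ->.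
Qed.

Lemma sum_noncollisions (g : T -> T) :
  (\sum_(p : T * T) (g p.1 != g p.2) + collisions g = #|T| ^ 2)%N.
Proof.
rewrite /collisions -sum1_card [X in (_ + X)%N]big_mkcond -big_split /= -mulnn -card_prod.
by rewrite -[RHS]sum1_card; apply: eq_bigr => p _; rewrite inE; case: eqP.
Qed.

(* A leaf [(z, z')] is merged by [b a^s]; only leaves with [a^s (b z) <> a^s (b z')] survive. *)
Lemma explore_leaves Q V : uniq (points Q) -> (forall z, z \in points Q -> V z = setT) ->
  #|fam V :&: [set b | stuck 0 Q b]|%:R <= (1 - rate rho 0) ^+ size Q * wt R V.
Proof.
have /andP[g0 g1] := rate_bounds 0 (ltW rho0).
elim: Q V => [|[z z'] Q IH] V.
  by move=> _ _; rewrite expr0 mul1r -card_fam ler_nat subset_leq_card ?subsetIl.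
rewrite /= inE negb_or => /andP[/andP[zz' zQ] /andP[z'Q uQ]] fr.
have z'z : z' != z by rewrite eq_sym.
have Vz : V z = setT by apply: fr; rewrite inE eqxx.
have Vz' : V z' = setT by apply: fr; rewrite !inE eqxx orbT.
rewrite (fam_reveal2 _ z'z Vz Vz') natr_sum.
have n2 : n ^+ 2 != 0 by rewrite expf_neq0 ?lt0r_neq0.
set X := (1 - rate rho 0) ^+ size Q * (wt R V / n ^+ 2).
apply: (@le_trans _ _ (\sum_(p : T * T) (iter s a p.1 != iter s a p.2)%:R * X)).
  apply: ler_sum => -[y y'] _ /=; case: (iter s a y =P iter s a y') => [e|_] /=.
    rewrite mul0r -[leRHS]/(0%:R) ler_nat leqn0 cards_eq0 -subset0.
    apply/subsetP => b /setIP[/(fam_upd2 z'z Vz Vz')[bz bz']].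
    rewrite inE /stuck /= => /andP[/negP nm _]; case: nm; rewrite muln0 add0n; apply: mergeable_b.
    rewrite bz bz' -(addn0 s); apply: mergeable_iter_a; rewrite e; exact: mergeable_refl.
  rewrite mul1r /X -(wt_upd2 (y, y') z'z Vz Vz') mulfK //.
  apply: le_trans (IH _ uQ _) => [|t tQ].
    rewrite ler_nat subset_leq_card // setIS //; apply/subsetP => b.
    by rewrite !inE => /andP[].
  rewrite !upd_other ?fr ?inE ?tQ ?orbT //.
    by apply: contraNneq zQ => <-.
  by apply: contraNneq z'Q => <-.
rewrite -mulr_suml -natr_sum.
have cN := sum_noncollisions (iter s a); move: cN; set N := (\sum_p _)%N => cN.
have {}cN : N%:R = n ^+ 2 - (collisions (iter s a))%:R :> R.
  by rewrite -natrX -cN natrD addrK.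
have -> : (1 - rate rho 0) ^+ (size Q).+1 * wt R V = (1 - rate rho 0) * n ^+ 2 * X.
  by rewrite /X exprS; field; rewrite lt0r_neq0.
apply: ler_wpM2r.
  by rewrite /X mulr_ge0 ?exprn_ge0 ?subr_ge0 // divr_ge0 ?wt_ge0 // exprn_ge0 // ltW.
(* [rate rho 0] is [1 / (rho + 1)], slightly below the merging probability [1 / rho]; the added one
   is what gives [x >= 1] in [rate_step]. *)
rewrite cN mulrBl mul1r lerD2l lerN2 /rate expr0 divr1 /survive big_ord0 mul1r.
by rewrite mulrC ler_pdivrMr ?addr_gt0 // mulrDr mulr1 mulrC; apply: le_trans a_merges _; rewrite lerDl.
Qed.

(* If [b z] lies in [touching O], the children [b z] and [a (b z)] of [z] are not both fresh. *)
Definition touching O : {set T} := [set y | (y \in O) || (a y \in O)].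

(** By [a_collisions], [O] has at most [sqrt (3 n #|O|)] preimages under [a]. Since
    [(3 / 4) ^ 2 >= 1 / 2], a bound on [O] that halves with each level keeps this below a multiple
    of [kill e * n]. *)
Lemma card_touching O e : (1024 * 2 ^ e.+1 * #|O| <= #|T|)%N ->
  #|touching O|%:R <= kill R e / 2 * n.
Proof.
move=> h; have k0 := kill_gt0 R e; have k8 := kill_le R e.
pose x : R := #|[set y | a y \in O]|%:R.
have x2 : x ^+ 2 <= 3 * n * #|O|%:R.
  rewrite -natrX -!natrM ler_nat mulnC; apply: leq_trans (preim_sqr_le a O) _.
  by rewrite leq_mul2l a_collisions orbT.
have O2 : #|O|%:R <= n * (kill R e ^+ 2 / 32).
  have : (1024 * 2 ^ e.+1 * #|O|)%:R <= n by rewrite ler_nat.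
  rewrite !natrM natrX exprS; set z : R := 2 ^+ e; set o : R := #|O|%:R => h'.
  have z0 : 0 < z by rewrite exprn_gt0.
  have k2 : 1 <= kill R e ^+ 2 * 64 * z.
    rewrite /kill exprMn exprVn -exprM mulnC exprM.
    have -> : ((3 / 4) ^+ 2) ^+ e / 8 ^+ 2 * 64 * z = (9 / 8) ^+ e :> R.
      have -> : (3 / 4) ^+ 2 = (9 / 8) / 2 :> R by field.
      by rewrite expr_div_n -/z; field; rewrite gt_eqF.
    by rewrite exprn_ege1 //; lra.
  have o0 : 0 <= o by rewrite ler0n.
  have : o * 1 <= o * (kill R e ^+ 2 * 64 * z) by rewrite ler_wpM2l.
  have : o * z * 2048 * kill R e ^+ 2 <= n * kill R e ^+ 2.
    by rewrite ler_wpM2r ?sqr_ge0 //; lra.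
  set k2' := kill R e ^+ 2; lra.
have x1 : x <= kill R e * n * (5 / 16).
  rewrite -[leLHS]ger0_norm ?ler0n // -[leRHS]ger0_norm; last first.
    by have := mulr_gt0 k0 n0; lra.
  rewrite -ler_sqr ?nnegrE ?normr_ge0 // !real_normK ?num_real //.
  apply: le_trans x2 _; have kn : 0 <= (kill R e * n) ^+ 2 by exact: sqr_ge0.
  have : 3 * n * #|O|%:R <= 3 * n * (n * (kill R e ^+ 2 / 32)).
    by rewrite ler_wpM2l // mulr_ge0 // ltW.
  have -> : 3 * n * (n * (kill R e ^+ 2 / 32)) = (kill R e * n) ^+ 2 * (3 / 32) by field.
  by move=> h1; rewrite exprMn; lra.
have tle : #|touching O|%:R <= #|O|%:R + x.
  rewrite -natrD ler_nat; apply: leq_trans (leq_card_setU _ _).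
  by apply: subset_leq_card; apply/subsetP => y; rewrite !inE.
have O1 : #|O|%:R <= n * kill R e / 256.
  apply: le_trans O2 _; have : n * kill R e * kill R e <= n * kill R e * (1 / 8).
    by rewrite ler_wpM2l // mulr_ge0 // ltW.
  by rewrite expr2; lra.
have := mulr_gt0 n0 k0; lra.
Qed.

(* [Q] holds the pairs of height [e.+1] still to be processed, [Q'] the children created so far, and
   [O] contains every state that is revealed, scheduled or fixed by [a].  The size constraints
   express that a generation at height [e] has at most [M / 2 ^ e] pairs. *)
Lemma explore_level e :
  (forall Q V O, uniq (points Q) -> {subset points Q <= O} ->
    (forall z, z \in points Q -> V z = setT) -> (forall z, z \notin O -> V z = setT) ->
    (forall z, a z = z -> z \in O) ->
    (#|O| * 2 ^ e <= 4 * M)%N -> (size Q * 2 ^ e <= M)%N ->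
    #|fam V :&: [set b | stuck e Q b]|%:R <= (1 - rate rho e) ^+ size Q * wt R V) ->
  forall Q Q' V O, uniq (points Q' ++ points Q) -> {subset points Q' ++ points Q <= O} ->
    (forall z, z \in points Q' ++ points Q -> V z = setT) ->
    (forall z, z \notin O -> V z = setT) ->
    (forall z, a z = z -> z \in O) ->
    ((#|O| + 4 * size Q) * 2 ^ e.+1 <= 8 * M)%N ->
    ((2 * size Q + size Q') * 2 ^ e.+1 <= 2 * M)%N ->
  #|fam V :&: [set b | stuck e.+1 Q b && stuck e Q' b]|%:R
    <= (1 - rate rho e.+1) ^+ size Q * (1 - rate rho e) ^+ size Q' * wt R V.
Proof.
move=> IHe; have /andP[g0 g1] := rate_bounds e (ltW rho0).
have /andP[g0' g1'] := rate_bounds e.+1 (ltW rho0).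
elim=> [|[z z'] Q IH] Q' V O.
  rewrite cats0 muln0 addn0 muln0 add0n expnS => uQ QO fr rev fixO c1 c2.
  rewrite expr0 mul1r; apply: le_trans (IHe Q' V O uQ QO fr rev fixO _ _); last first.
  - by rewrite -[leqRHS]mul1n; exact: halve_budget.
  - exact: halve_budget.
  by rewrite ler_nat subset_leq_card // setIS //; apply/subsetP => b; rewrite !inE /=.
move=> uQ QO fr rev fixO c1 c2.
have [zO z'O] : z \in O /\ z' \in O by split; apply: QO; rewrite mem_cat !inE eqxx ?orbT.
have [Vz Vz'] : V z = setT /\ V z' = setT.
  by split; apply: fr; rewrite mem_cat !inE eqxx ?orbT.
have {}uQ : uniq (z :: z' :: points Q' ++ points Q).
  by move: uQ; rewrite -[points (_ :: _)]/([:: z; z'] ++ points Q) uniq_catCA.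
move: uQ; rewrite /= inE negb_or => /andP[/andP[zz' zPQ] /andP[z'PQ uPQ]].
have z'z : z' != z by rewrite eq_sym.
have PQin t : t \in points Q' ++ points Q -> t \in points Q' ++ points ((z, z') :: Q).
  by rewrite !mem_cat !inE => /orP[->|->]; rewrite ?orbT.
have PQO t : t \in points Q' ++ points Q -> t \in O by move=> /PQin /QO.
have n2 : 0 < n ^+ 2 by rewrite exprn_gt0.
set W := wt R V / n ^+ 2; have W0 : 0 <= W by rewrite divr_ge0 ?wt_ge0 // ltW.
have WE p : wt R (upd (upd V z [set p.1]) z' [set p.2]) = W.
  by rewrite /W -(wt_upd2 p z'z Vz Vz') mulfK ?lt0r_neq0.
set X := (1 - rate rho e.+1) ^+ size Q * (1 - rate rho e) ^+ size Q' * W.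
have X0 : 0 <= X by apply: mulr_ge0 => //; apply: mulr_ge0; rewrite exprn_ge0 ?subr_ge0.
(* [p] holds the values [b z] and [b z']. If [p] is good, these and their images under [a] are four
   distinct states outside of [O]; [y != a y] holds since [O] contains the fixed points of [a]. *)
pose good (p : T * T) :=
  (p.1 \notin touching O) && (p.2 \notin touching (O :|: [set p.1; a p.1])).
pose g2 := (1 - rate rho e) ^+ 2.
have g2_le1 : g2 <= 1 by rewrite exprn_ile1 ?subr_ge0 ?gerBl.
have fresh y y' O' : O \subset O' -> forall t, t \notin O' ->
    upd (upd V z [set y]) z' [set y'] t = setT.
  move=> OO' t tO'; have tO : t \notin O by apply: contra tO'; exact: (subsetP OO').
  by rewrite !upd_other ?rev //; apply: contraNneq tO => ->.
have old y y' t : t \in points Q' ++ points Q ->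
    upd (upd V z [set y]) z' [set y'] t = setT.
  move=> tPQ; rewrite !upd_other ?fr ?PQin //.
    by apply: contraNneq zPQ => <-.
  by apply: contraNneq z'PQ => <-.
(* A bad pair of values leaves the node childless; a good one adds two children to [Q'], which gain
   the factor [g2]. *)
have step p : #|fam (upd (upd V z [set p.1]) z' [set p.2]) :&:
    [set b | stuck e.+1 ((z, z') :: Q) b && stuck e Q' b]|%:R
    <= (g2 + (~~ good p)%:R * (1 - g2)) * X.
  case: p => y y' /=; case: (boolP (good (y, y'))) => [|_] /=; last first.
    rewrite mul1r addrC subrK mul1r /X -(WE (y, y')) /=.
    apply: le_trans (IH Q' _ O uPQ PQO (old y y') (fresh y y' O (subxx _)) fixO _ _).
    - rewrite ler_nat subset_leq_card // setIS //; apply/subsetP => b.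
      by rewrite !in_set stuck_cons => /andP[/andP[_ ->] ->].
    - by apply: occupied_budget c1; rewrite leq_addr.
    - exact: (@queue_budget _ _ 0) c2.
  rewrite mul0r addr0 /good /= !inE !negb_or.
  move=> /andP[/andP[yO ayO] /andP[/and3P[y'O y'y y'ay] /and3P[ay'O ay'y ay'ay]]].
  pose O2 := O :|: [set y; a y; y'; a y'].
  have yay : y != a y by apply: contraNneq yO => /esym; exact: fixO.
  have y'ay' : y' != a y' by apply: contraNneq y'O => /esym; exact: fixO.
  have notPQ t : t \notin O -> t \notin points Q' ++ points Q.
    by apply: contra; exact: PQO.
  have new t : t \notin O -> upd (upd V z [set y]) z' [set y'] t = setT.
    exact: (fresh y y' O (subxx _)).
  pose Q2 := (y, y') :: (a y, a y') :: Q'.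
  have -> : g2 * X = (1 - rate rho e.+1) ^+ size Q * (1 - rate rho e) ^+ size Q2
      * wt R (upd (upd V z [set y]) z' [set y']).
    by rewrite /X /g2 (WE (y, y')) /= !exprS expr0; ring.
  have OO2 : O \subset O2 by exact: subsetUl.
  have O2c : (#|O2| <= #|O| + 4)%N.
    apply: leq_trans (leq_card_setU _ _) _; rewrite leq_add2l.
    apply: leq_trans (card_size [:: y; a y; y'; a y']).
    by apply: subset_leq_card; apply/subsetP => t; rewrite !inE -!orbA.
  have Q2pts : points Q2 ++ points Q = [:: y; y'; a y; a y'] ++ points Q' ++ points Q by [].
  apply: le_trans (IH Q2 _ O2 _ _ _ (fresh y y' O2 OO2) _ _ _).
  - rewrite ler_nat subset_leq_card //; apply/subsetP => b /setIP[bV].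
    rewrite in_setI bV !in_set !stuck_cons => /andP[/andP[nm ->] ->]; rewrite andbT /=.
    have [bz bz'] := fam_upd2 z'z Vz Vz' bV.
    (* The child [(y, y')] is reached by [b] and [(a y, a y')] by [b a], so two more letters cover
       both. *)
    have e2 : (2 * e.+1 + s.+1 = (2 * e + s.+1).+2)%N by rewrite mulnS.
    rewrite e2 /= in nm; apply/andP; split.
      apply: contra nm => m; apply: mergeable_b; rewrite bz bz'.
      exact: mergeable_leq m.
    apply: contra nm => m; apply: mergeable_b; rewrite bz bz'; exact: mergeable_a.
  - rewrite Q2pts cat_uniq uPQ andbT; apply/andP; split.
      by rewrite /= !inE !negb_or [y == y']eq_sym y'y yay [y == a y']eq_sym ay'y y'ay y'ay'
        [a y == a y']eq_sym ay'ay.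
    apply/hasPn => t tPQ; have tO := PQO t tPQ; rewrite !inE !negb_or.
    by apply/and4P; split; apply: contraTneq tO => ->.
  - move=> t; rewrite Q2pts mem_cat => /orP[|/PQO tO]; last by rewrite inE tO.
    by rewrite !inE => /or4P[] ->; rewrite ?orbT.
  - move=> t; rewrite Q2pts mem_cat => /orP[|/old //].
    by rewrite !inE => /or4P[] /eqP ->; exact: new.
  - by move=> t /fixO tO; rewrite inE tO.
  - exact: occupied_budget c1.
  - exact: (@queue_budget _ _ 2) c2.
rewrite (fam_reveal2 _ z'z Vz Vz') natr_sum.
apply: (le_trans (ler_sum _ (fun p _ => step p))); rewrite -mulr_suml.
have -> : (1 - rate rho e.+1) ^+ size ((z, z') :: Q) * (1 - rate rho e) ^+ size Q' * wt R V
    = (1 - rate rho e.+1) * n ^+ 2 * X.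
  by rewrite /X /W /= exprS; field; rewrite lt0r_neq0.
apply: ler_wpM2r => //; rewrite big_split /= sum_cst card_prod natrM -expr2 -mulr_suml.
(* Each of the two values is responsible for half of [kill R e]. *)
have bad : \sum_(p : T * T) (~~ good p)%:R <= kill R e * n ^+ 2.
  apply: (@le_trans _ _ (\sum_(y : T) \sum_(y' : T)
     ((y \in touching O)%:R + (y' \in touching (O :|: [set y; a y]))%:R))).
    rewrite pair_bigA /=; apply: ler_sum => -[y y'] _; rewrite -natrD ler_nat /good /=.
    by case: (y \in _); case: (y' \in _).
  under eq_bigr do rewrite big_split /= sum_cst.
  have cnt (S : {set T}) : \sum_(y : T) (y \in S)%:R = #|S|%:R :> R.
    by rewrite -natr_sum -sum1_card [in RHS]big_mkcond.
  under eq_bigr do rewrite cnt.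
  rewrite big_split /= -mulr_suml cnt.
  have h1 : #|touching O|%:R <= kill R e / 2 * n.
    by apply/card_touching/(touching_budget _ c1 M_small); rewrite leq_addr.
  have h2 y : #|touching (O :|: [set y; a y])|%:R <= kill R e / 2 * n.
    apply/card_touching/(touching_budget _ c1 M_small).
    apply: leq_trans (leq_card_setU _ _) _; rewrite leq_add2l cards2.
    by case: (_ != _).
  have : \sum_(y : T) #|touching (O :|: [set y; a y])|%:R <= kill R e / 2 * n * n.
    by rewrite -sum_cst; apply: ler_sum => y _; exact: h2.
  have := ler_wpM2r (ltW n0) h1; rewrite expr2; lra.
have k0 := kill_gt0 R e; have k8 := kill_le R e.
apply: (@le_trans _ _ (g2 * n ^+ 2 + kill R e * n ^+ 2 * (1 - g2))).
  by rewrite lerD2l ler_wpM2r // subr_ge0.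
have -> : g2 * n ^+ 2 + kill R e * n ^+ 2 * (1 - g2) = (kill R e + (1 - kill R e) * g2) * n ^+ 2.
  by ring.
by rewrite ler_wpM2r ?rate_step // ltW.
Qed.

(** All trees are grown together, one generation at a time, so that their failure probabilities
    multiply although they share the set of revealed states. *)
Lemma explore e Q V O : uniq (points Q) -> {subset points Q <= O} ->
  (forall z, z \in points Q -> V z = setT) -> (forall z, z \notin O -> V z = setT) ->
  (forall z, a z = z -> z \in O) ->
  (#|O| * 2 ^ e <= 4 * M)%N -> (size Q * 2 ^ e <= M)%N ->
  #|fam V :&: [set b | stuck e Q b]|%:R <= (1 - rate rho e) ^+ size Q * wt R V.
Proof.
elim: e Q V O => [|e IH] Q V O uQ QO fr rev fixO c1 c2; first exact: explore_leaves.
have := explore_level IH (Q := Q) (Q' := [::]) (V := V) (O := O) uQ QO fr rev fixO.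
rewrite expr0 mulr1 addn0 => h; apply: le_trans (h _ _); last first.
- by rewrite -mulnA leq_mul2l.
- exact: start_budget.
by rewrite ler_nat subset_leq_card // setIS //; apply/subsetP => b; rewrite !inE andbT.
Qed.
End Exploration.

(** A maximal independent set dominates the graph: every vertex belongs to it or is one of its at
    most [2 * #|I|] neighbours. *)
Lemma independent_third (J : finType) (e : rel J) :
  irreflexive e -> symmetric e -> (forall i, (#|[set j | e i j]| <= 2)%N) ->
  exists2 I : {set J}, {in I &, forall i j, ~~ e i j} & (#|J| <= 3 * #|I|)%N.
Proof.
move=> irr sym deg.
pose P (I : {set J}) := [forall i in I, forall j in I, ~~ e i j].
have [I /maxsetP[/forall_inP PI Imax]] : {I | maxset P I}.
  by apply: ex_maxset; exists set0; apply/forall_inP => i; rewrite inE.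
exists I => [i j iI jI|]; first by have /forall_inP/(_ j jI) := PI i iI.
have cover j : j \in I :|: \bigcup_(i in I) [set j | e i j].
  rewrite inE; case: (boolP (j \in I)) => //= jI; apply: contraT => h.
  have PjI : P (j |: I).
    have ne i : i \in I -> ~~ e i j.
      by move=> iI; apply: contra h => eij; apply/bigcupP; exists i; rewrite ?inE.
    apply/forall_inP => x /setU1P[->|xI]; apply/forall_inP => y /setU1P[->|yI].
    - by rewrite irr.
    - by rewrite sym ne.
    - exact: ne.
    - by have /forall_inP/(_ y yI) := PI x xI.
  by move: jI; rewrite -(Imax _ PjI (subsetUr _ _)) setU11.
have -> : #|J| = #|I :|: \bigcup_(i in I) [set j | e i j]|.
  by rewrite -[LHS]cardsT; congr #|pred_of_set _|; apply/setP => j; rewrite cover inE.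
apply: leq_trans (leq_card_setU _ _) _; rewrite [leqRHS]mulSn leq_add2l.
rewrite mulnC -sum_nat_const.
apply: (@leq_trans (\sum_(i in I) #|[set j | e i j]|)); last exact: leq_sum.
elim/big_rec2: _ => [|i x S _ h]; first by rewrite cards0.
by apply: leq_trans (leq_card_setU _ _) _; rewrite leq_add2l.
Qed.

(** * Failure probability for one pair of states with long orbits *)

Section Pairs.
Variables (R : realType) (T : finType) (a : {ffun T -> T}) (s r D : nat) (rho : R).
Notation n := (#|T|%:R : R).
Hypothesis T0 : (0 < #|T|)%N.
Hypothesis rho0 : 0 < rho.
Hypothesis a_merges : n ^+ 2 <= rho * (collisions (iter s a))%:R.
Hypothesis a_collisions : (collisions a <= 3 * #|T|)%N.
Hypothesis a_fixed : (#|[set y | a y == y]| <= r)%N.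
Hypothesis r_small : (1024 * (8 * (r * 2 ^ D)) <= #|T|)%N.
Hypothesis D_large : rho <= 2 ^+ D.

Lemma mem_points (Q : seq (T * T)) t :
  reflect (exists2 p, p \in Q & t = p.1 \/ t = p.2) (t \in points Q).
Proof.
apply: (iffP flattenP) => [[x /mapP[p pQ ->]]|[p pQ tp]].
  by rewrite !inE => /orP[]/eqP ->; exists p; auto.
exists [:: p.1; p.2]; first by apply/mapP; exists p.
by rewrite !inE; case: tp => ->; rewrite eqxx ?orbT.
Qed.

Lemma size_points (Q : seq (T * T)) : size (points Q) = (2 * size Q)%N.
Proof. by elim: Q => //= p Q IH; rewrite -/(points Q) IH mulnS. Qed.

Lemma long_orbit_inj u m i j : u \notin short_orbit a m -> (i < m)%N -> (j < m)%N ->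
  iter i a u = iter j a u -> i = j.
Proof.
rewrite inE negbK => unq im jm e; apply/eqP.
by rewrite -(nth_uniq u _ _ unq) ?size_traject // !nth_traject // e.
Qed.

(* The roots are the pairs [(a^i u, a^i v)]; since [a^i u = a^j v] happens for at most one [j], a
   third of the indices yields pairwise disjoint pairs. *)
Lemma pr_not_mergeable u v : u \notin short_orbit a (3 * r) -> v \notin short_orbit a (3 * r) ->
  pr R (fun b : {ffun T -> T} => ~~ mergeable a b (3 * r + (2 * D + s.+1)) u v) <= (3 / 4) ^+ r.
Proof.
move=> uS vS; pose m := (3 * r)%N.
(* If the two orbits meet at equal times, a power of [a] already merges the pair and the failure
   event is empty. *)
case: (boolP [exists i : 'I_m, iter i a u == iter i a v]) => [/existsP[i /eqP iuv]|].
  apply: (@le_trans _ _ 0); last by rewrite exprn_ge0 //; lra.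
  rewrite prE [X in X%:R](_ : _ = 0%N) ?mul0r //; apply: eq_card0 => b.
  rewrite unfold_in; apply/negbF/(mergeable_leq (l := (i + 0)%N)); last first.
    apply: mergeable_iter_a; rewrite iuv; exact: mergeable_refl.
  by rewrite addn0 (leq_trans (ltnW (ltn_ord i))) // leq_addr.
move=> /existsPn nuv.
pose e (i j : 'I_m) := (iter i a u == iter j a v) || (iter j a u == iter i a v).
have [|||I Iind cI] := @independent_third _ e.
- by move=> i; rewrite /e (negbTE (nuv i)).
- by move=> i j; rewrite /e orbC.
- move=> i; apply: (@leq_trans (#|[set j : 'I_m | iter j a v == iter i a u]|
      + #|[set j : 'I_m | iter j a u == iter i a v]|)%N).
    apply: leq_trans (leq_card_setU _ _); apply: subset_leq_card.
    by apply/subsetP => j; rewrite !inE /e eq_sym.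
  apply: (@leq_add _ _ 1 1); apply/card_le1_eqP => j j'; rewrite !inE => /eqP h /eqP h'; apply: val_inj.
    by apply: (long_orbit_inj vS); rewrite /= ?h ?h'.
  by apply: (long_orbit_inj uS); rewrite /= ?h ?h'.
rewrite card_ord leq_mul2l /= in cI.
pose f (i : 'I_m) := (iter i a u, iter i a v).
pose Q := [seq f i | i <- take r (enum I)].
have sQ : size Q = r by rewrite size_map size_takel // -cardE.
have uQ : uniq (points Q).
  have : uniq (take r (enum I)) by rewrite take_uniq // enum_uniq.
  have : {subset take r (enum I) <= I} by move=> i /mem_take; rewrite mem_enum.
  rewrite /Q; elim: (take r _) => //= i l IH sub /andP[il ul].
  have iI : i \in I by apply: sub; rewrite inE eqxx.
  have subl : {subset l <= I} by move=> j jl; apply: sub; rewrite inE jl orbT.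
  rewrite -/(points _) inE negb_or (nuv i) IH // andbT /=.
  have out j : j \in l -> [/\ j \in I, j != i & j \in l].
    by move=> jl; split => //; [exact: subl|apply: contraNneq il => <-].
  apply/andP; split; apply/mem_points => -[_ /mapP[j /out[jI ji jl] ->]]; rewrite /f /= => -[h|h].
  - by move/eqP: ji; apply; apply/val_inj/(long_orbit_inj uS (ltn_ord j) (ltn_ord i)); rewrite h.
  - by have := Iind i j iI jI; rewrite /e /= h eqxx.
  - by have := Iind i j iI jI; rewrite /e /= h eqxx orbT.
  - by move/eqP: ji; apply; apply/val_inj/(long_orbit_inj vS (ltn_ord j) (ltn_ord i)); rewrite h.
pose O := [set y | a y == y] :|: [set t in points Q].
have := @explore R T a s (r * 2 ^ D) rho T0 rho0 a_merges a_collisions r_small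
  D Q (fun=> setT) O uQ.
rewrite -card_fam => h.
have F : fam (fun _ : T => [set: T]) = setT.
  by apply/setP => b; rewrite in_setT; apply/famP => x; rewrite in_setT.
rewrite F setTI cardsT sQ in h.
rewrite prE ler_pdivrMr ?ltr0n ?card_ffun_gt0 //.
apply: (@le_trans _ _ #|[set b : {ffun T -> T} | stuck a s D Q b]|%:R).
  rewrite ler_nat subset_leq_card //; apply/subsetP => b; rewrite inE unfold_in => nm.
  apply/allP => _ /mapP[i _ ->] /=; apply: contra nm => /mergeable_iter_a.
  by apply: mergeable_leq; rewrite leq_add2r ltnW.
apply: le_trans (h _ _ _ _ _ _) _ => //.
- by move=> t tQ; rewrite !inE tQ orbT.
- by move=> z az; rewrite !inE az eqxx.
- rewrite mulnA leq_mul2r; apply/orP; right.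
  apply: leq_trans (leq_card_setU _ _) _; rewrite -[leqRHS]/(4 * r)%N.
  have c2 : (#|[set t in points Q]| <= 2 * r)%N.
    rewrite -[in leqRHS]sQ -size_points cardsE; exact: card_size.
  by move: a_fixed c2; lia.
have g1 : 1 / 4 <= rate rho D by rewrite rate_ge // ltW.
have /andP[_ g2] := rate_bounds D (ltW rho0).
by rewrite ler_wpM2r // lerXn2r ?nnegrE //; lra.
Qed.

End Pairs.

(** * Rounds *)

Section Resampling.
Variables (R : realType) (T : finType).
Hypothesis T0 : (0 < #|T|)%N.
Notation FT := {ffun T -> T}.
Notation n := (#|T|%:R : R).
Implicit Types (b : FT) (X : {set T}).

Definition ovr X b b' : FT := [ffun x => if x \in X then b x else b' x].

(* [Rv b] is a stopping set: it is determined by the values of [b] on it.  Swapping [b] and [b']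
   outside [Rv b] is therefore an involution on pairs. *)
Lemma mean_resample (Rv : FT -> {set T}) (F : FT -> R) :
  (forall b b', {in Rv b, b' =1 b} -> Rv b' = Rv b) ->
  mean F = mean (fun b => mean (fun b' => F (ovr (Rv b) b b'))).
Proof.
move=> stop; have Rvo b b' : Rv (ovr (Rv b) b b') = Rv b.
  by apply: stop => x xR; rewrite ffunE xR.
pose h (p : FT * FT) := (ovr (Rv p.1) p.1 p.2, ovr (Rv p.1) p.2 p.1).
have hK : involutive h.
  move=> [b b']; rewrite /h /= Rvo; congr pair; apply/ffunP => x; rewrite !ffunE;
    by case: (x \in Rv b).
have N0 : #|{: FT}|%:R != 0 :> R by rewrite pnatr_eq0 -lt0n card_ffun_gt0.
rewrite /mean -mulr_suml pair_bigA /=.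
have -> : \sum_(p : FT * FT) F (ovr (Rv p.1) p.1 p.2) = \sum_(p : FT * FT) F p.1.
  by rewrite [RHS](reindex_inj (inv_inj hK)).
rewrite -(pair_bigA _ (fun b _ => F b)) /=.
rewrite [X in _ = X / _ / _](eq_bigr (fun b => F b * #|{: FT}|%:R)) => [|b _]; last exact: sum_cst.
by rewrite -mulr_suml mulfK.
Qed.

Lemma le_mean_resample (Rv : FT -> {set T}) (F G : FT -> R) :
  (forall b b', {in Rv b, b' =1 b} -> Rv b' = Rv b) ->
  (forall b, mean (fun b' => F (ovr (Rv b) b b')) <= mean (fun b' => G (ovr (Rv b) b b'))) ->
  mean F <= mean G.
Proof.
by move=> stop h; rewrite (mean_resample F stop) (mean_resample G stop); apply: le_mean.
Qed.

Lemma pr_fam (V : T -> {set T}) : pr R (fun b : FT => [forall x, b x \in V x]) =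
  \prod_x (#|V x|%:R / n).
Proof.
rewrite prE big_split /= prodfV -/(wt R V) -card_fam; congr (_ / _).
  by congr _%:R; apply: eq_card => b; rewrite [in RHS]inE unfold_in.
by rewrite card_ffun prodr_const -natrX.
Qed.

Lemma pr_mem x X : pr R (fun b : FT => b x \in X) = #|X|%:R / n.
Proof.
have n0 : n != 0 by rewrite pnatr_eq0 -lt0n.
transitivity (pr R (fun b : FT => [forall z, b z \in upd (fun=> setT) x X z])).
  apply: eq_mean => b; congr (_ %:R); congr nat_of_bool; apply/idP/forallP => [bx z|/(_ x)].
    by rewrite /upd; case: eqP => [->|]; rewrite ?inE.
  by rewrite upd_same.
rewrite pr_fam (bigD1 x) //= upd_same big1 ?mulr1 // => z zx.
by rewrite upd_other // cardsT divff.
Qed.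

Lemma pr_avoid (G X : {set T}) :
  pr R (fun b : FT => [forall x in G, b x \notin X]) = (1 - #|X|%:R / n) ^+ #|G|.
Proof.
have n0 : n != 0 by rewrite pnatr_eq0 -lt0n.
transitivity (pr R (fun b : FT => [forall z, b z \in if z \in G then ~: X else setT])).
  apply: eq_mean => b; congr (_ %:R); congr nat_of_bool.
  by apply: eq_forallb => z; case: (z \in G); rewrite !inE.
rewrite pr_fam (bigID (mem G)) /= [X in _ * X]big1 ?mulr1; last first.
  by move=> z /negbTE ->; rewrite cardsT divff.
rewrite (eq_bigr (fun=> 1 - #|X|%:R / n)) ?prodr_const // => z ->.
by rewrite cardsCs setCK natrB ?max_card // mulrBl divff.
Qed.

(* Either [(1 - p) ^ g > (1 - eta) ^ 2], and then the left-hand side is at most [2 eta], or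
   increasing [g] adds at most [(1 - eta) ^ 2 * p] to it. *)
Lemma occupancy_le (p eta : R) g : 0 <= p <= 1 -> 0 <= eta <= 1 ->
  1 - (1 - p) ^+ g <= p + 4 * eta ^+ 2 + (1 - eta) ^+ 2 * (g%:R * p).
Proof.
move=> /andP[p0 p1] /andP[e0 e1]; elim: g => [|g IH].
  by rewrite expr0 mul0r mulr0 subrr addr0 addr_ge0 // mulr_ge0 ?sqr_ge0.
rewrite exprS -natr1; set P := (1 - p) ^+ g in IH *.
have P0 : 0 <= P by rewrite exprn_ge0 // subr_ge0.
have P1 : P <= 1 by rewrite exprn_ile1 ?subr_ge0 // gerBl.
have [h|h] := leP P ((1 - eta) ^+ 2).
  have : p * P <= p * (1 - eta) ^+ 2 by rewrite ler_wpM2l.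
  by move: IH; set q := (1 - eta) ^+ 2; lra.
have D : 1 - P <= g%:R * p.
  rewrite /P; elim: g {IH P P0 P1 h} => [|g IH]; first by rewrite expr0 mul0r subrr.
  rewrite exprS -natr1; have : p * (1 - p) ^+ g <= p * 1.
    by rewrite ler_wpM2l // exprn_ile1 ?subr_ge0 // gerBl.
  by move: IH; set P := (1 - p) ^+ g; lra.
have h1 : 1 - P <= 2 * eta by move: h; rewrite sqrrB; nra.
have h2 : (1 - eta) ^+ 2 * (1 - P) <= (1 - eta) ^+ 2 * (g%:R * p) by rewrite ler_wpM2l ?sqr_ge0.
have h3 : 0 <= (1 - eta) ^+ 2 * p by rewrite mulr_ge0 ?sqr_ge0.
have h4 : p * P <= p * 1 by rewrite ler_wpM2l.
have h5 : (2 * eta) * (1 - P) <= (2 * eta) * (2 * eta) by rewrite ler_wpM2l ?mulr_ge0.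
have h6 : 0 <= eta ^+ 2 * (1 - P) by rewrite mulr_ge0 ?sqr_ge0 ?subr_ge0.
move: h2 h3 h4 h5 h6; rewrite !expr2; lra.
Qed.

(** A cell of relative size [p] is hit with probability [1 - (1 - p) ^ #|G|]. In the bound of
    [occupancy_le] the cell sizes enter linearly and sum to one, so their distribution drops out. *)
Lemma mean_new_image (g : T -> T) (G : {set T}) (eta : R) : 0 <= eta <= 1 ->
  mean (fun b : FT => #|[set g (b x) | x in G]|%:R) <=
    1 + 4 * eta ^+ 2 * #|[set g x | x : T]|%:R + (1 - eta) ^+ 2 * #|G|%:R.
Proof.
move=> e01; have n0 : 0 < n by rewrite ltr0n.
set C := [set g x | x : T].
pose cell c := [set x | g x == c].
have sum_cell : \sum_(c in C) #|cell c|%:R = n.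
  rewrite -natr_sum -[#|T|]sum1_card; congr _%:R.
  rewrite [RHS](partition_big g (mem C)) /=; last by move=> x _; exact: imset_f.
  by apply: eq_bigr => c _; rewrite sum1_card; apply: eq_card => x; rewrite !inE unfold_in.
have -> : mean (fun b : FT => #|[set g (b x) | x in G]|%:R) =
    \sum_(c in C) (1 - (1 - #|cell c|%:R / n) ^+ #|G|).
  rewrite (eq_mean (G := fun b => \sum_(c in C) (c \in [set g ((b : FT) x) | x in G])%:R)).
    rewrite mean_sum; apply: eq_bigr => c _; rewrite -pr_avoid.
    rewrite -[LHS]/(pr R _) (prC _ _ (card_ffun_gt0 T0)); congr (1 - _).
    apply: eq_mean => b; congr (_ %:R); congr nat_of_bool => /=.
    apply/idP/forall_inP => [h x xG|h].
      by rewrite inE; apply: contra h => /eqP <-; apply: imset_f.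
    by apply/imsetP => -[x xG e]; have := h x xG; rewrite inE e eqxx.
  move=> b; rewrite -natr_sum -sum1_card; congr _%:R.
  rewrite [LHS]big_mkcond [RHS]big_mkcond /=; apply: eq_bigr => c _.
  case: (boolP (c \in C)) => cC; first by case: (_ \in _).
  by case: imsetP => // -[x _ e]; rewrite e imset_f in cC.
apply: (@le_trans _ _ (\sum_(c in C) (#|cell c|%:R / n + 4 * eta ^+ 2
    + (1 - eta) ^+ 2 * (#|G|%:R * (#|cell c|%:R / n))))).
  apply: ler_sum => c _; apply: occupancy_le => //.
  by rewrite divr_ge0 // ler_pdivrMr // mul1r ler_nat max_card.
rewrite !big_split /= sumr_const -!mulr_sumr -mulr_suml sum_cell divff ?lt0r_neq0 //.
by rewrite mulr1 mulr_natr.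
Qed.

Lemma mean_return (G X : {set T}) :
  mean (fun b : FT => #|[set x in G | b x \in X]|%:R) = #|G|%:R * #|X|%:R / n.
Proof.
rewrite (eq_mean (G := fun b : FT => \sum_(x in G) (b x \in X)%:R)); last first.
  move=> b; rewrite -natr_sum -sum1_card; congr _%:R.
  rewrite [LHS]big_mkcond [RHS]big_mkcond /=; apply: eq_bigr => x _.
  by rewrite inE; case: (x \in G); case: (b x \in X).
rewrite mean_sum (eq_bigr (fun=> #|X|%:R / n)) => [|x _]; last exact: pr_mem.
by rewrite sumr_const -[LHS]mulr_natl mulrA.
Qed.

End Resampling.

(** * Decrease of the image over the rounds *)

Section Rounds.
Variables (R : realType) (T : finType) (g : T -> T).
Hypothesis T0 : (0 < #|T|)%N.
Notation FT := {ffun T -> T}.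
Notation n := (#|T|%:R : R).
Implicit Types (b : FT) (X : {set T}).

Definition core : {set T} := [set g x | x : T].

(** For [g = a^t] this is the image of the word [a^t b a^t b^2 a^t ... b^i a^t], see
    [stage_word]. *)
Fixpoint stage b i : {set T} :=
  if i is j.+1 then [set g (iter j.+1 b x) | x in stage b j] else core.

Definition level b i : {set T} := [set iter i b x | x in core].
(* Round [i.+1] applies [b] to the points of [level b i]; those of [seen b i] were already used by
   an earlier round. *)
Definition seen b i : {set T} := \bigcup_(j < i) level b j.
Definition stale b i : {set T} := level b i :&: seen b i.
Notation N := (#|core|%:R : R).

Lemma stage_core b i : stage b i \subset core.
Proof. by case: i => // i; apply/subsetP => _ /imsetP[x _ ->]; exact: imset_f. Qed.

Lemma seenS b i : seen b i.+1 = seen b i :|: level b i.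
Proof. by rewrite /seen big_ord_recr. Qed.

Lemma level_seen b i j : (j < i)%N -> level b j \subset seen b i.
Proof. by move=> ji; exact: (bigcup_sup (Ordinal ji)). Qed.

Section Agreement.
Variables (b b' : FT) (i : nat).
Hypothesis agree : {in seen b i, b' =1 b}.

Lemma iter_agree j c : c \in core -> (j <= i)%N -> iter j b' c = iter j b c.
Proof.
move=> cC; elim: j => //= j IH ji; rewrite IH ?(ltnW ji) // agree //.
by apply: (subsetP (level_seen b ji)); exact: imset_f.
Qed.

Lemma level_agree j : (j <= i)%N -> level b' j = level b j.
Proof. by move=> ji; apply: eq_in_imset => c cC; exact: iter_agree. Qed.

Lemma seen_agree : seen b' i = seen b i.
Proof. by apply: eq_bigr => j _; rewrite level_agree // ltnW. Qed.

Lemma stage_agree j : (j <= i)%N -> stage b' j = stage b j.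
Proof.
elim: j => //= j IH ji; rewrite IH ?(ltnW ji) //; apply: eq_in_imset => c cA.
by rewrite -!iterS iter_agree // (subsetP (stage_core b j)).
Qed.

Lemma stale_agree : stale b' i = stale b i.
Proof. by rewrite /stale level_agree // seen_agree. Qed.

End Agreement.

Lemma agree_ovr b b' i : {in seen b i, ovr (seen b i) b b' =1 b}.
Proof. by move=> x xS; rewrite ffunE xS. Qed.

Lemma seen_stop i b b' : {in seen b i, b' =1 b} -> seen b' i = seen b i.
Proof. exact: seen_agree. Qed.

Lemma card_level b i : (#|level b i| <= #|core|)%N.
Proof. exact: leq_imset_card. Qed.

Lemma card_seen b i : (#|seen b i| <= i * #|core|)%N.
Proof.
elim: i => [|i IH]; first by rewrite /seen big_ord0 cards0.
rewrite seenS mulSn addnC; apply: leq_trans (leq_card_setU _ _) _.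
by rewrite leq_add ?card_level.
Qed.

(** A stale point of the next level is the image of a stale point, or a fresh value that falls into
    the at most [(i + 1) N] seen states. The latter adds [(i + 1) N ^ 2 / n] on average. *)
Lemma mean_stale i : mean (fun b => #|stale b i|%:R) <= i%:R ^+ 2 * N ^+ 2 / n.
Proof.
have n0 : 0 < n by rewrite ltr0n.
elim: i => [|i IH].
  have stale0 b : #|stale b 0|%:R = 0 :> R by rewrite /stale /seen big_ord0 setI0 cards0.
  by rewrite (eq_mean stale0) (mean_cst _ (card_ffun_gt0 T0)) expr0n !mul0r.
apply: (@le_trans _ _ (mean (fun b => #|stale b i|%:R + N * (i.+1%:R * N) / n))).
  apply: (le_mean_resample T0 (@seen_stop i)) => b.
  set o := ovr _ _.
  rewrite [leRHS](eq_mean (G := fun=> #|stale b i|%:R + N * (i.+1%:R * N) / n)); last first.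
    by move=> b' /=; rewrite (stale_agree (@agree_ovr b b' i)).
  rewrite mean_cst ?card_ffun_gt0 //.
  apply: (@le_trans _ _ (mean (fun b' : FT => #|stale b i|%:R +
      #|[set x in level b i :\: seen b i | b' x \in seen b i.+1]|%:R))).
    apply: le_mean => b'; rewrite -natrD ler_nat.
    have ag := @agree_ovr b b' i.
    have lev : level (o b') i.+1 = [set o b' x | x in level b i].
      rewrite -(level_agree ag (leqnn i)) /level -imset_comp.
      by apply: eq_imset => x /=.
    have -> : stale (o b') i.+1 = [set o b' x | x in level b i] :&: seen b i.+1.
      by rewrite /stale lev !seenS (seen_agree ag) (level_agree ag (leqnn i)).
    apply: (@leq_trans #|[set o b' x | x in stale b i :|:
        [set x in level b i :\: seen b i | b' x \in seen b i.+1]]|).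
      apply: subset_leq_card; apply/subsetP => _ /setIP[/imsetP[x xL ->]].
      case: (boolP (x \in seen b i)) => xS oS; apply: imset_f.
        by rewrite !inE xL xS.
      move: oS; rewrite /o ffunE (negbTE xS) => oS.
      by rewrite in_setU in_set in_setD xL xS oS orbT.
    by apply: leq_trans (leq_imset_card _ _) _; exact: leq_card_setU.
  rewrite meanD mean_cst ?card_ffun_gt0 // lerD2l mean_return //.
  rewrite ler_wpM2r ?invr_ge0 // -!natrM ler_nat leq_mul ?card_seen //.
  by rewrite (leq_trans _ (card_level b i)) // subset_leq_card // subsetDl.
rewrite meanD mean_cst ?card_ffun_gt0 //; apply: le_trans (lerD IH (lexx _)) _.
rewrite -mulrDl ler_wpM2r ?invr_ge0 // -natr1; have := ler0n R i.
have := sqr_ge0 N; rewrite !expr2; set Z := N * N; set z : R := i%:R => Z0 z0.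
have -> : N * ((z + 1) * N) = (z + 1) * Z by rewrite /Z; ring.
rewrite -mulrDl ler_wpM2r //; nra.
Qed.

(** Given the values on [seen b i], the other points of the current image carry fresh uniform
    values, to which [mean_new_image] applies with [eta = 1 / (i + 2)]; the seen ones are stale. *)
Lemma mean_stage_step i : mean (fun b => #|stage b i.+1|%:R) <=
  mean (fun b => #|stale b i|%:R) + 1 + 4 * (i.+2%:R^-1) ^+ 2 * N
  + (1 - i.+2%:R^-1) ^+ 2 * mean (fun b => #|stage b i|%:R).
Proof.
set eta : R := i.+2%:R^-1.
have e01 : 0 <= eta <= 1 by rewrite invr_ge0 ler0n invf_le1 ?ltr0n // ler1n.
rewrite -meanZ -(addrA _ 1 _) -(mean_cst (1 + 4 * eta ^+ 2 * N) (card_ffun_gt0 T0)) -!meanD.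
apply: (le_mean_resample T0 (@seen_stop i)) => b; set o := ovr _ _.
set c : R := #|stale b i|%:R + (1 + 4 * eta ^+ 2 * N) + (1 - eta) ^+ 2 * #|stage b i|%:R.
rewrite [leRHS](eq_mean (G := fun=> c)); last first.
  by move=> b' /=; rewrite (stale_agree (@agree_ovr b b' i)) (stage_agree (@agree_ovr b b' i)).
rewrite mean_cst ?card_ffun_gt0 //.
pose D := [set iter i b x | x in stage b i].
have DL : D \subset level b i by apply: imsetS; exact: stage_core.
apply: (@le_trans _ _ (mean (fun b' : FT => #|D :&: seen b i|%:R +
    #|[set g (b' x) | x in D :\: seen b i]|%:R))).
  apply: le_mean => b'; rewrite -natrD ler_nat.
  have ag := @agree_ovr b b' i.
  have -> : stage (o b') i.+1 = [set g (o b' x) | x in D].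
    rewrite /= (stage_agree ag (leqnn i)) /D -imset_comp; apply: eq_in_imset => x xA /=.
    by rewrite (iter_agree ag) // (subsetP (stage_core b i)).
  apply: (@leq_trans #|[set g (o b' x) | x in D :&: seen b i] :|:
      [set g (b' x) | x in D :\: seen b i]|).
    apply: subset_leq_card; apply/subsetP => _ /imsetP[x xD ->]; rewrite inE.
    case: (boolP (x \in seen b i)) => xS; apply/orP; [left|right].
      by apply: imset_f; rewrite inE xD.
    by apply/imsetP; exists x; rewrite ?inE ?xS // /o ffunE (negbTE xS).
  apply: leq_trans (leq_card_setU _ _) _; rewrite leq_add2r; exact: leq_imset_card.
rewrite meanD mean_cst ?card_ffun_gt0 // /c -addrA lerD //.
  by rewrite ler_nat subset_leq_card // setSI.
apply: le_trans (mean_new_image _ _ _ e01) _ => //; rewrite lerD2l ler_wpM2l ?sqr_ge0 //.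
rewrite ler_nat (leq_trans (subset_leq_card (subsetDl _ _))) //.
exact: leq_imset_card.
Qed.

(** Without error terms [4 N / (i + 1)] solves the recursion of [mean_stage_step] exactly; each
    round adds an error of at most [1 + k ^ 2 N ^ 2 / n]. *)
Lemma mean_stage k : mean (fun b => #|stage b k|%:R) <=
  4 * N / k.+1%:R + k%:R * (1 + k%:R ^+ 2 * N ^+ 2 / n).
Proof.
have n0 : 0 < n by rewrite ltr0n.
suff: forall i, (i <= k)%N -> mean (fun b => #|stage b i|%:R) <=
  4 * N / i.+1%:R + i%:R * (1 + k%:R ^+ 2 * N ^+ 2 / n) by exact.
elim=> [|i IH] ik.
  have -> : mean (fun b => #|stage b 0|%:R) = N by exact: (mean_cst N (card_ffun_gt0 T0)).
  by rewrite mul0r addr0 divr1; have := ler0n R #|core|; lra.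
have {}IH := IH (ltnW ik); set Z := k%:R ^+ 2 * N ^+ 2 / n in IH *.
have Z0 : 0 <= Z by rewrite divr_ge0 // mulr_ge0 ?sqr_ge0.
have hs : mean (fun b => #|stale b i|%:R) <= Z.
  apply: le_trans (mean_stale i) _; rewrite ler_wpM2r ?invr_ge0 // ler_wpM2r ?sqr_ge0 //.
  by rewrite lerXn2r ?nnegrE ?ler0n // ler_nat ltnW.
apply: le_trans (mean_stage_step i) _.
have i0 := ler0n R i; have N0 := ler0n R #|core|.
set m := mean (fun b => #|stage b i|%:R) in IH *.
have e1 : 0 <= 1 - (i.+2%:R : R)^-1 <= 1.
  by rewrite subr_ge0 gerBl invr_ge0 ler0n andbT invf_le1 ?ltr0n // ler1n.
have : (1 - i.+2%:R^-1) ^+ 2 * m <= 4 * N * (i.+1%:R / i.+2%:R ^+ 2) + i%:R * (1 + Z).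
  apply: (@le_trans _ _ ((1 - i.+2%:R^-1) ^+ 2 * (4 * N / i.+1%:R) + i%:R * (1 + Z))).
    apply: le_trans (ler_wpM2l (sqr_ge0 _) IH) _; rewrite mulrDr lerD2l ler_piMl //.
      by rewrite mulr_ge0 // addr_ge0.
    by rewrite exprn_ile1 //; case/andP: e1.
  rewrite lerD2r le_eqVlt; apply/orP; left; apply/eqP.
  by rewrite -[i.+2]addn1 -[i.+1]addn1 !natrD; field; apply/andP; split; apply: lt0r_neq0; lra.
have -> : 4 * (i.+2%:R^-1) ^+ 2 * N = 4 * N / i.+2%:R - 4 * N * (i.+1%:R / i.+2%:R ^+ 2).
  by rewrite -[i.+2]addn1 -[i.+1]addn1 !natrD; field; apply: lt0r_neq0; lra.
have -> : i.+1%:R * (1 + Z) = i%:R * (1 + Z) + (1 + Z) by rewrite -natr1 mulrDl mul1r.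
set W1 := 4 * N * _; set W2 := 4 * N / _; set W3 := i%:R * _; set W4 := _ * m.
by clearbody W1 W2 W3 W4 Z => h; lra.
Qed.

End Rounds.

(** * Synchronizing words *)

Section Words.
Variables (T : finType) (a b : {ffun T -> T}).

Lemma run_cat w1 w2 x : run a b (w1 ++ w2) x = run a b w2 (run a b w1 x).
Proof. exact: foldl_cat. Qed.

Lemma run_nseq_a i x : run a b (nseq i false) x = iter i a x.
Proof. by elim: i x => //= i IH x; rewrite IH -iterSr. Qed.

Lemma run_nseq_b i x : run a b (nseq i true) x = iter i b x.
Proof. by elim: i x => //= i IH x; rewrite IH -iterSr. Qed.

Lemma stage_word t k : exists2 w, (size w <= t * k.+1 + k * k.+1)%N &
  [set run a b w x | x : T] = stage (iter t a) b k.
Proof.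
elim: k => [|k [w sw wE]].
  exists (nseq t false); first by rewrite size_nseq; lia.
  by apply: eq_imset => x; rewrite run_nseq_a.
exists (w ++ nseq k.+1 true ++ nseq t false); first by rewrite !size_cat !size_nseq; lia.
rewrite [RHS]/= -wE -imset_comp; apply: eq_imset => x.
by rewrite !run_cat run_nseq_a run_nseq_b.
Qed.

(** Merging two states of the current set lowers its cardinality by at least one. *)
Lemma greedy_word l c (S : {set T}) : (forall x y, mergeable a b l x y) ->
  (0 < #|S| <= c)%N ->
  exists2 w, (size w <= c * l)%N & #|[set run a b w x | x in S]| = 1%N.
Proof.
move=> mer; elim: c S => [|c IH] S; first by case: #|S|.
move=> /andP[S0 Sc]; have [S1|] := leqP #|S| 1.
  exists [::] => //; rewrite (_ : [set _ | _ in S] = S) ?imset_id //.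
  by apply/eqP; rewrite eqn_leq S1 S0.
move=> /card_gt1P[x [y [xS yS xy]]].
have [w sw wxy] := mergeable_word (mer x y).
have lt : (#|[set run a b w z | z in S]| < #|S|)%N.
  rewrite ltn_neqAle leq_imset_card andbT; apply: contra xy => /imset_injP inj.
  by apply/eqP/inj.
have [|w' sw' w'E] := IH [set run a b w z | z in S].
  rewrite -[X in _ && X]ltnS (leq_trans lt Sc) andbT; apply/card_gt0P; exists (run a b w x).
  exact: imset_f.
exists (w ++ w'); first by rewrite size_cat mulSn leq_add.
rewrite -w'E -imset_comp; congr #|pred_of_set _|; apply: eq_imset => z.
by rewrite run_cat.
Qed.

End Words.

(** * Failure events of a random pair of maps and their union bound *)

Section Assembly.
Variables (R : realType) (T : finType).
Hypothesis T0 : (0 < #|T|)%N.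
Notation FT := {ffun T -> T}.
Notation n := (#|T|%:R : R).
Variables (t k s r D M0 m Ks beta : nat).

Let n0 : 0 < n. Proof. by rewrite ltr0n. Qed.
Let FT0 := card_ffun_gt0 T0.

Definition fixed (a : FT) : {set T} := [set y | a y == y].

(* When this fails, every state has at most one of [x], [b x], [b (b x)] in the exceptional set,
   so that for each pair one of the three words [1], [b], [b b] leads outside of it. *)
Definition returning (a b : FT) : bool :=
  [exists v in short_orbit a (3 * r),
    (b v \in short_orbit a (3 * r)) || (b (b v) \in short_orbit a (3 * r))].

(** [3 * r] letters lead to a root, [2 * D] descend its tree, and [s.+1] merge a leaf. *)
Definition merging_length : nat := 3 * r + (2 * D + s.+1).

Definition unmergeable (a b : FT) : bool :=
  [exists p : T * T, [&& p.1 \notin short_orbit a (3 * r), p.2 \notin short_orbit a (3 * r)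
     & ~~ mergeable a b merging_length p.1 p.2]].

Definition typical (a b : FT) : bool :=
  [&& #|stage (iter t a) b k| <= m, ~~ returning a b & ~~ unmergeable a b]%N.

Definition sync_length : nat := t * k.+1 + k * k.+1 + m * (2 + merging_length).

Lemma typical_mergeable (a b : FT) x y : ~~ returning a b -> ~~ unmergeable a b ->
  mergeable a b (2 + merging_length) x y.
Proof.
move=> nr nu; pose S := short_orbit a (3 * r).
have next v : v \in S -> b v \notin S /\ b (b v) \notin S.
  move=> vS; apply/andP; rewrite -negb_or; apply: contra nr => h.
  by apply/existsP; exists v; rewrite vS.
have [i i2 /andP[xi yi]] : exists2 i, (i <= 2)%N & (iter i b x \notin S) && (iter i b y \notin S).
  have pr z : (z \notin S) && (b z \notin S) || (z \notin S) && (b (b z) \notin S) ||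
      (b z \notin S) && (b (b z) \notin S).
    case: (boolP (z \in S)) => [/next[-> ->] //|_] /=.
    by case: (boolP (b z \in S)) => [/next[->]|_] //=; rewrite ?orbT.
  case/orP: (pr x) => [/orP[]|] /andP[x1 x2]; case/orP: (pr y) => [/orP[]|] /andP[y1 y2];
    first [by exists 0%N => //; exact/andP | by exists 1%N => //; exact/andP
    | by exists 2%N => //; exact/andP].
apply: (mergeable_leq (l := (i + merging_length)%N)); first by rewrite leq_add2r.
apply: mergeable_iter_b; apply: contraT => nm; case/negP: nu.
by apply/existsP; exists (iter i b x, iter i b y); rewrite /= xi yi.
Qed.

Lemma typical_sync (a b : FT) : typical a b ->
  exists2 w, (size w <= sync_length)%N & #|[set run a b w x | x : T]| = 1%N.
Proof.
case/and3P => sm nr nu; have [w sw wE] := stage_word a b t k.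
have [|w' sw' w'E] := @greedy_word _ a b _ m (stage (iter t a) b k)
    (fun x y => typical_mergeable x y nr nu).
  rewrite sm andbT -wE; have /card_gt0P[x _] := T0.
  by apply/card_gt0P; exists (run a b w x); exact: imset_f.
exists (w ++ w'); first by rewrite size_cat leq_add.
rewrite -w'E -wE -imset_comp; congr #|pred_of_set _|; apply: eq_imset => z.
by rewrite run_cat.
Qed.

Lemma mean_pair (F : FT -> FT -> R) :
  mean (fun p : FT * FT => F p.1 p.2) = mean (fun a => mean (F a)).
Proof. by rewrite /mean -mulr_suml pair_bigA card_prod natrM invfM mulrA. Qed.

Lemma pr_fst (P : pred FT) : pr R (fun p : FT * FT => P p.1) = pr R P.
Proof.
rewrite /pr (mean_pair (fun a _ => (P a)%:R)); apply: eq_mean => a.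
by rewrite mean_cst.
Qed.

Lemma pr_large_image u M : (0 < M)%N ->
  pr R (fun a : FT => (M <= #|img a u|)%N) <= (survival R u * n + u%:R) / M%:R.
Proof.
move=> M_gt0; have M0' : 0 < M%:R :> R by rewrite ltr0n.
apply: (@le_trans _ _ (mean (fun a : FT => #|img a u|%:R) / M%:R)).
  apply: le_trans (markov M0' _) => //; apply: sub_pr => a; by rewrite ler_nat.
by rewrite ler_wpM2r ?invr_ge0 //; exact: mean_img.
Qed.

(** The event includes a bound on the image of [a^t] because the error term of [mean_stage] is
    quadratic in its size, of which only the mean is estimated. *)
Lemma pr_large_stage : (0 < m)%N ->
  pr R (fun p : FT * FT => (#|img p.1 t| <= M0)%N && (m < #|stage (iter t p.1) p.2 k|)%N)
  <= (4 * (survival R t * n + t%:R) / k.+1%:R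
      + k%:R * (1 + k%:R ^+ 2 * M0%:R ^+ 2 / n)) / m%:R.
Proof.
move=> m_gt0; have m0 : 0 < m%:R :> R by rewrite ltr0n.
pose F (a b : FT) : R := (#|img a t| <= M0)%N%:R * #|stage (iter t a) b k|%:R.
apply: (@le_trans _ _ (mean (fun p : FT * FT => F p.1 p.2) / m%:R)).
  apply: le_trans (markov m0 _) => [|p]; last by rewrite mulr_ge0.
  by apply: sub_pr => p /andP[h1 h2]; rewrite /F h1 mul1r ler_nat ltnW.
rewrite ler_wpM2r ?invr_ge0 // mean_pair.
apply: (@le_trans _ _ (mean (fun a : FT => 4 / k.+1%:R * #|img a t|%:R
    + k%:R * (1 + k%:R ^+ 2 * M0%:R ^+ 2 / n)))).
  apply: le_mean => a; rewrite /F meanZ.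
  have q0 : 0 <= k%:R * (1 + k%:R ^+ 2 * M0%:R ^+ 2 / n).
    by rewrite mulr_ge0 // addr_ge0 // mulr_ge0 ?invr_ge0 // mulr_ge0 ?sqr_ge0.
  case: leqP => h; last first.
    by rewrite mul0r addr_ge0 // mulr_ge0 // divr_ge0.
  rewrite mul1r; apply: le_trans (mean_stage _ _ T0 k) _.
  rewrite -[core _]/(img a t) mulrAC lerD2l ler_wpM2l // lerD2l ler_wpM2r ?invr_ge0 //.
  by rewrite ler_wpM2l ?sqr_ge0 // lerXn2r ?nnegrE ?ler_nat.
rewrite meanD meanZ mean_cst // lerD2r [leRHS]mulrAC.
by rewrite ler_wpM2l ?divr_ge0 //; exact: mean_img.
Qed.

Lemma pr_many_fixed : pr R (fun a : FT => (r < #|fixed a|)%N) <= r.+1%:R^-1.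
Proof.
have r0 : 0 < r.+1%:R :> R by [].
apply: (@le_trans _ _ (mean (fun a : FT => #|fixed a|%:R) / r.+1%:R)).
  apply: le_trans (markov r0 _) => //; by apply: sub_pr => a; rewrite ler_nat.
rewrite -[leRHS]mul1r ler_wpM2r ?invr_ge0 //.
rewrite (eq_mean (G := fun a : FT => \sum_y (a y == y)%:R)); last first.
  move=> a; rewrite -natr_sum -sum1_card; congr _%:R.
  by rewrite [LHS]big_mkcond /=; apply: eq_bigr => y _; rewrite inE; case: eqP.
rewrite mean_sum; apply: (@le_trans _ _ (\sum_(y : T) n^-1)); last first.
  by rewrite sum_cst mulVf // lt0r_neq0.
apply: ler_sum => y _; apply: le_trans (pr_closing R T0 y (isT : 0 < 1)%N).
by apply: sub_pr => a /=.
Qed.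

Lemma pr_many_short : (0 < beta)%N ->
  pr R (fun a : FT => (beta < #|short_orbit a (3 * r)|)%N) <= (3 * r)%:R ^+ 2 / beta%:R.
Proof.
move=> b_gt0; have b0 : 0 < beta%:R :> R by rewrite ltr0n.
apply: (@le_trans _ _ (mean (fun a : FT => #|short_orbit a (3 * r)|%:R) / beta%:R)).
  apply: le_trans (markov b0 _) => //; apply: sub_pr => a; rewrite ler_nat; exact: ltnW.
by rewrite ler_wpM2r ?invr_ge0 // mean_short_orbit.
Qed.

(** Reveal [b] at [v] only: if [b v] lies outside of [S], it differs from [v], and the value of [b]
    there is still uniform. *)
Lemma pr_iter2 (v : T) (S : {set T}) : v \in S ->
  pr R (fun b : FT => (b v \notin S) && (b (b v) \in S)) <= #|S|%:R / n.
Proof.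
move=> vS.
rewrite /pr (mean_resample T0 (Rv := fun=> [set v])) //.
apply: (@le_trans _ _ (mean (fun _ : FT => #|S|%:R / n))); last by rewrite mean_cst.
apply: le_mean => b; case: (boolP (b v \in S)) => bvS.
  rewrite (eq_mean (G := fun=> 0)) ?mean_cst ?divr_ge0 // => b'.
  by rewrite !ffunE inE eqxx bvS.
rewrite -(pr_mem R T0 (b v) S); apply: le_mean => b'; rewrite ler_nat.
rewrite !ffunE !inE eqxx bvS /= ; case: eqP => // e.
by rewrite e vS in bvS.
Qed.

Lemma pr_returning (a : FT) :
  pr R (returning a) <= 2 * #|short_orbit a (3 * r)|%:R ^+ 2 / n.
Proof.
set S := short_orbit a (3 * r).
apply: (@le_trans _ _ (\sum_(v in S) (2 * #|S|%:R / n))); last first.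
  by rewrite sumr_const -[leLHS]mulr_natl le_eqVlt; apply/orP; left; apply/eqP; ring.
apply: (@le_trans _ _ (\sum_(v in S) pr R (predU (fun b : FT => b v \in S)
    (fun b => (b v \notin S) && (b (b v) \in S))))); last first.
  apply: ler_sum => v vS; apply: le_trans (prU _ _ _) _.
  by rewrite -mulrA mulr_natl mulr2n lerD ?pr_iter2 // pr_mem.
apply: le_trans (pr_exists _ _ _); apply: sub_pr => b /existsP[v /andP[vS h]].
apply/existsP; exists v; rewrite vS /=; move: h.
by case: (b v \in S).
Qed.

Lemma pr_conditional (P : pred FT) (Q : FT -> pred FT) c : 0 <= c ->
  (forall a, P a -> pr R (Q a) <= c) -> pr R (fun p : FT * FT => P p.1 && Q p.1 p.2) <= c.
Proof.
move=> c0 h; rewrite /pr (mean_pair (fun a b => (P a && Q a b)%:R)).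
apply: (@le_trans _ _ (mean (fun _ : FT => c))); last by rewrite mean_cst.
apply: le_mean => a; case: (boolP (P a)) => [/h //|_] /=.
by rewrite mean_cst.
Qed.

Hypothesis r_small : (1024 * (8 * (r * 2 ^ D)) <= #|T|)%N.
Hypothesis Ks_small : (Ks <= 2 ^ D)%N.

Definition mixing (a : FT) : bool :=
  [&& #|img a s| <= Ks, collisions a <= 3 * #|T| & #|fixed a| <= r]%N.

Lemma pr_unmergeable a : mixing a -> pr R (unmergeable a) <= n ^+ 2 * (3 / 4) ^+ r.
Proof.
case/and3P => aK ac af; pose S := short_orbit a (3 * r).
have Ks0 : 0 < Ks%:R :> R.
  rewrite ltr0n (leq_trans _ aK) //; have /card_gt0P[x _] := T0.
  by apply/card_gt0P; exists (iter s a x); exact: imset_f.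
(* The bound [Ks] on the image of [a^s] serves as [rho]. *)
have merges : n ^+ 2 <= Ks%:R * (collisions (iter s a))%:R.
  rewrite -natrX -natrM ler_nat; apply: leq_trans (collisions_img (iter s a)) _.
  by rewrite leq_mul2r aK orbT.
have KD : Ks%:R <= 2 ^+ D :> R by rewrite -natrX ler_nat.
have c0 : 0 <= (3 / 4) ^+ r :> R by rewrite exprn_ge0 //; lra.
pose A (p : T * T) := (p.1 \notin S) && (p.2 \notin S).
apply: (@le_trans _ _ (\sum_(p | A p) (3 / 4) ^+ r)); last first.
  rewrite sumr_const -[leLHS]mulr_natl ler_wpM2r // -natrX ler_nat.
  by rewrite (leq_trans (max_card _)) // card_prod mulnn.
apply: (@le_trans _ _ (\sum_(p | A p)
    pr R (fun b : FT => ~~ mergeable a b merging_length p.1 p.2))); last first.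
  by apply: ler_sum => p /andP[h1 h2]; exact: (pr_not_mergeable T0 Ks0 merges).
apply: le_trans (pr_exists _ _ _); apply: sub_pr => b /existsP[p h].
by apply/existsP; exists p; rewrite -andbA.
Qed.

Lemma pr_not_typical : (0 < M0)%N -> (0 < m)%N -> (0 < Ks)%N -> (0 < beta)%N ->
  pr R (fun p : FT * FT => ~~ typical p.1 p.2) <=
    (survival R t * n + t%:R) / M0%:R
    + (4 * (survival R t * n + t%:R) / k.+1%:R
        + k%:R * (1 + k%:R ^+ 2 * M0%:R ^+ 2 / n)) / m%:R
    + (survival R s * n + s%:R) / Ks%:R
    + 2 / n + r.+1%:R^-1 + (3 * r)%:R ^+ 2 / beta%:R
    + 2 * beta%:R ^+ 2 / n + n ^+ 2 * (3 / 4) ^+ r.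
Proof.
move=> M_gt0 m_gt0 K_gt0 b_gt0.
(* [B2], [B7] and [B8] depend on both maps and include the properties of [a] under which they are
   unlikely; the other events concern [a] alone. *)
pose B1 (p : FT * FT) := (M0 <= #|img p.1 t|)%N.
pose B2 (p : FT * FT) := (#|img p.1 t| <= M0)%N && (m < #|stage (iter t p.1) p.2 k|)%N.
pose B3 (p : FT * FT) := (Ks <= #|img p.1 s|)%N.
pose B4 (p : FT * FT) := (3 * #|T| <= collisions p.1)%N.
pose B5 (p : FT * FT) := (r < #|fixed p.1|)%N.
pose B6 (p : FT * FT) := (beta < #|short_orbit p.1 (3 * r)|)%N.
pose B7 (p : FT * FT) := (#|short_orbit p.1 (3 * r)| <= beta)%N && returning p.1 p.2.
pose B8 (p : FT * FT) := mixing p.1 && unmergeable p.1 p.2.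
apply: (@le_trans _ _ (pr R (predU (predU (predU (predU (predU (predU (predU B1 B2) B3) B4)
    B5) B6) B7) B8))).
  apply: sub_pr => p; rewrite /typical /= /in_mem /= /B1 /B2 /B3 /B4 /B5 /B6 /B7 /B8 /mixing.
  case: (leqP M0 #|img p.1 t|) => //= h1; rewrite (ltnW h1) /=.
  case: (leqP #|stage _ _ _| m) => //= h2.
  case: (leqP Ks #|img p.1 s|) => //= h3; rewrite (ltnW h3) /=.
  case: (leqP (3 * #|T|) (collisions p.1)) => //= h4; rewrite (ltnW h4) /=.
  case: (leqP #|fixed p.1| r) => //= h5.
  case: (leqP #|short_orbit p.1 (3 * r)| beta) => //= h6.
  by rewrite negb_and !negbK.
have c0 : 0 <= n ^+ 2 * (3 / 4) ^+ r by rewrite mulr_ge0 ?sqr_ge0 // exprn_ge0 //; lra.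
apply: (le_trans (prU _ _ _)); apply: lerD; last first.
  by apply: (@pr_conditional mixing) => // a; exact: pr_unmergeable.
apply: (le_trans (prU _ _ _)); apply: lerD; last first.
  apply: (@pr_conditional (fun a => (#|short_orbit a (3 * r)| <= beta)%N)).
    by rewrite divr_ge0 // mulr_ge0 ?sqr_ge0.
  move=> a ab; apply: le_trans (pr_returning a) _.
  by rewrite ler_wpM2r ?invr_ge0 // ler_wpM2l // lerXn2r ?nnegrE ?ler_nat.
apply: (le_trans (prU _ _ _)); apply: lerD; last first.
  rewrite (pr_fst (fun a => (beta < #|short_orbit a (3 * r)|)%N)); exact: pr_many_short.
apply: (le_trans (prU _ _ _)); apply: lerD; last first.
  rewrite (pr_fst (fun a => (r < #|fixed a|)%N)); exact: pr_many_fixed.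
apply: (le_trans (prU _ _ _)); apply: lerD; last first.
  rewrite (pr_fst (fun a => (3 * #|T| <= collisions a)%N)); exact: pr_collisions.
apply: (le_trans (prU _ _ _)); apply: lerD; last first.
  rewrite (pr_fst (fun a => (Ks <= #|img a s|)%N)); exact: pr_large_image.
apply: (le_trans (prU _ _ _)); apply: lerD; last exact: pr_large_stage.
rewrite (pr_fst (fun a => (M0 <= #|img a t|)%N)); exact: pr_large_image.
Qed.

End Assembly.

(** * Choice of the parameters *)

Lemma poly_le_exp (K p : nat) : exists g0, forall g, (g0 <= g)%N -> (K * g ^ p <= 2 ^ g)%N.
Proof.
pose c := (2 * p.+1)%N.
exists (p.+1 * (K * c ^ p).+1)%N => g gg0; pose q := (g %/ p.+1)%N.
have qK : (K * c ^ p < q)%N by rewrite leq_divRL // mulnC.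
have gq : (g <= c * q)%N.
  have := ltn_ceil g (ltn0Sn p); rewrite -/q /c; have : (0 < q)%N by exact: leq_ltn_trans qK.
  by nia.
apply: (@leq_trans (K * (c * q) ^ p)); first by rewrite leq_mul2l; case: (p) => [|p']; rewrite ?expn0 ?orbT // leq_exp2r // gq orbT.
rewrite expnMn mulnA; apply: (@leq_trans (q ^ p.+1)); first by rewrite expnS leq_mul2r (ltnW qK) orbT.
apply: (@leq_trans ((2 ^ q) ^ p.+1)); first by rewrite leq_exp2r // ltnW // ltn_expl.
by rewrite -expnM leq_pexp2l // leq_divM.
Qed.

Lemma sqrS_le t : (t.+1 ^ 2 <= (t * (t + 4)).+1)%N.
Proof. by rewrite -mulnn mulnDr; nia. Qed.

(* [h ~ 1 / eps], [g ~ log2 n], [t ~ sqrt n] and [u ~ sqrt g]. *)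
Section Scales.
Variables (R : realType) (T : finType) (h g t u : nat).
Notation n := #|T|.
Hypothesis h_gt0 : (0 < h)%N.
Hypothesis n_g : (n < 2 ^ g)%N.
Hypothesis t_le : (t ^ 2 <= n)%N.
Hypothesis t_gt : (n < t.+1 ^ 2)%N.
Hypothesis u_ge : (g <= u ^ 2)%N.
Hypothesis u_le : (u ^ 2 <= 4 * g)%N.
Hypothesis g_large : (80 * h <= 9 * g)%N.
Hypothesis t_large : (1024 * 1024 * 16) * h%:R ^+ 6 * g%:R ^+ 6 <= t%:R :> R.

(** [Dr] and [D] exhaust the capacity allowed by [r_small]. The constants split the failure
    probability [1 / h] into [1 / 8] for [M0], [2 / 8] for [m], [1 / 8] for [Ks] and [4 / 8] for the
    remaining terms. *)
Let r := (9 * g)%N.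
Let Dr := (1024 * 8 * r)%N.
Let D := trunc_log 2 (n %/ Dr).
Let s := (160 * h * Dr)%N.
Let Ks := (n %/ (4 * Dr)).+1.
Let M0 := (40 * h * t)%N.
Let k := (h * u)%N.
Let m := (160 * (t %/ u).+1)%N.
Let beta := (r ^ 3)%N.

Let h1 : 1 <= h%:R :> R. Proof. by rewrite (ler_nat _ 1). Qed.

Let g_gt0 : (0 < g)%N.
Proof.
rewrite lt0n; apply: contraTneq g_large => ->.
by rewrite muln0 leqn0 muln_eq0 /= -lt0n h_gt0.
Qed.

Let g1 : 1 <= g%:R :> R. Proof. by rewrite (ler_nat _ 1). Qed.

Lemma pow_le (i j : nat) : (i <= 6)%N -> (j <= 6)%N ->
  (1024 * 1024 * 16) * (h%:R ^+ i * g%:R ^+ j) <= t%:R :> R.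
Proof.
move=> i6 j6; apply: le_trans t_large; rewrite -[leRHS]mulrA.
apply: ler_wpM2l; first by lra.
by apply: ler_pM; rewrite ?exprn_ge0 // ler_weXn2l.
Qed.

Let s_t : (s <= t)%N.
Proof.
rewrite -(ler_nat R) /s /Dr /r !natrM; have := @pow_le 1 1 isT isT.
have : 0 <= h%:R * g%:R :> R by rewrite mulr_ge0.
rewrite !expr1; lra.
Qed.

Let u_gt0 : (0 < u)%N.
Proof. by rewrite lt0n; apply: contraTneq u_ge => ->; rewrite -ltnNge. Qed.

Let u2R : u%:R ^+ 2 <= 4 * g%:R :> R.
Proof. by rewrite -natrX -natrM ler_nat. Qed.

Let u_sq : u%:R <= u%:R ^+ 2 :> R.
Proof. by rewrite expr2 ler_peMr // (ler_nat _ 1). Qed.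

Let hu_t : (h * u <= t)%N.
Proof.
rewrite -(ler_nat R) natrM; have := @pow_le 1 1 isT isT; rewrite !expr1.
have : h%:R * u%:R <= h%:R * (4 * g%:R) :> R by rewrite ler_wpM2l // (le_trans u_sq).
have : 0 <= h%:R * g%:R :> R by rewrite mulr_ge0.
lra.
Qed.

Let t_gt0 : (0 < t)%N. Proof. by apply: leq_trans hu_t; rewrite muln_gt0 h_gt0. Qed.

Let t_n : (t <= n)%N. Proof. by apply: leq_trans t_le; rewrite -mulnn leq_pmulr. Qed.

Let n_gt0 : (0 < n)%N. Proof. exact: leq_trans t_gt0 t_n. Qed.

Let Dr_gt0 : (0 < Dr)%N. Proof. by rewrite /Dr /r !muln_gt0 g_gt0. Qed.

Let s_gt0 : (0 < s)%N. Proof. by rewrite /s !muln_gt0 h_gt0. Qed.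

Let Dr_n : (Dr <= n)%N.
Proof. by apply: leq_trans t_n; apply: leq_trans s_t; rewrite /s leq_pmull // muln_gt0. Qed.

Let D_bounds : (2 ^ D <= n %/ Dr < 2 ^ D.+1)%N.
Proof. by apply: trunc_log_bounds => //; rewrite divn_gt0. Qed.

Lemma r_small : (1024 * (8 * (r * 2 ^ D)) <= n)%N.
Proof.
have /andP[h1' _] := D_bounds.
have -> : (1024 * (8 * (r * 2 ^ D)) = 2 ^ D * Dr)%N by rewrite /Dr [RHS]mulnC !mulnA.
by rewrite -leq_divRL.
Qed.

Lemma Ks_small : (Ks <= 2 ^ D)%N.
Proof.
have /andP[_] := D_bounds; rewrite ltn_divLR // expnS => h2.
rewrite /Ks ltn_divLR ?muln_gt0 // (leq_trans h2) //.
by rewrite -mulnA [leqRHS]mulnCA leq_mul2r orbT.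
Qed.

Let nR : 0 < n%:R :> R. Proof. by rewrite ltr0n. Qed.
Let tR : 0 < t%:R :> R. Proof. by rewrite ltr0n. Qed.
Let uR : 0 < u%:R :> R. Proof. by rewrite ltr0n. Qed.
Let hR : 0 < h%:R :> R. Proof. by rewrite ltr0n. Qed.
Let gR : 0 < g%:R :> R. Proof. by rewrite ltr0n. Qed.

Lemma survival_image v : (0 < v)%N -> (v ^ 2 <= n)%N ->
  survival R v * n%:R + v%:R <= 5 * n%:R / v%:R.
Proof.
move=> v0 v2; have vR : 0 < v%:R :> R by rewrite ltr0n.
have : v%:R <= n%:R / v%:R :> R by rewrite ler_pdivlMr // -natrM ler_nat mulnn.
have : survival R v * n%:R <= 4 / v%:R * n%:R.
  by rewrite ler_wpM2r // /survival ler_wpM2l // lef_pV2 ?posrE ?lerDl // addr_gt0.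
have -> : 4 / v%:R * n%:R = 4 * (n%:R / v%:R) :> R by ring.
have -> : 5 * n%:R / v%:R = 5 * (n%:R / v%:R) :> R by ring.
lra.
Qed.

Lemma survival_image_t : survival R t * n%:R + t%:R <= 5 * t%:R.
Proof.
suff : survival R t * n%:R <= 4 * t%:R by lra.
rewrite /survival mulrAC ler_pdivrMr ?ltr_wpDl //.
have : n%:R <= (t * (t + 4))%:R :> R by rewrite ler_nat -ltnS (leq_trans t_gt) // sqrS_le.
rewrite natrM natrD; lra.
Qed.

Lemma term_image : (survival R t * n%:R + t%:R) / M0%:R <= 1 / (8 * h%:R).
Proof.
have MR : 0 < M0%:R :> R by rewrite ltr0n /M0 !muln_gt0 h_gt0 t_gt0.
rewrite ler_pdivrMr //; apply: le_trans survival_image_t _.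
by rewrite /M0 !natrM mulrC le_eqVlt; apply/orP; left; apply/eqP; field; rewrite lt0r_neq0.
Qed.

Lemma m_ge : 160 * t%:R / u%:R <= m%:R :> R.
Proof.
rewrite ler_pdivrMr // -!natrM ler_nat /m -mulnA leq_mul2l /=.
by rewrite ltnW // ltn_ceil.
Qed.

Lemma M0_sq : M0%:R ^+ 2 / n%:R <= 1600 * h%:R ^+ 2 :> R.
Proof.
rewrite ler_pdivrMr // /M0 !natrM.
have : t%:R ^+ 2 <= n%:R :> R by rewrite -natrX ler_nat.
have : 0 <= h%:R ^+ 2 :> R by rewrite sqr_ge0.
by rewrite !exprMn; nra.
Qed.

Lemma term_stage : (4 * (survival R t * n%:R + t%:R) / k.+1%:R
    + k%:R * (1 + k%:R ^+ 2 * M0%:R ^+ 2 / n%:R)) / m%:R <= 2 / (8 * h%:R) :> R.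
Proof.
have tu : 0 < 160 * t%:R / u%:R :> R by rewrite divr_gt0 // mulr_gt0.
have mR : 0 < m%:R :> R by exact: lt_le_trans tu m_ge.
have kR : 0 < k%:R :> R by rewrite ltr0n /k muln_gt0 h_gt0.
rewrite ler_pdivrMr //; apply: (@le_trans _ _ (2 / (8 * h%:R) * (160 * t%:R / u%:R))); last first.
  by rewrite ler_wpM2l ?m_ge // divr_ge0 // mulr_ge0.
(* One half pays for the harmonic term, the other for the accumulated error of the rounds. *)
have -> : 2 / (8 * h%:R) * (160 * t%:R / u%:R) = 20 * t%:R / (h%:R * u%:R) + 20 * t%:R / (h%:R * u%:R) :> R.
  by field; rewrite !lt0r_neq0.
have huR : 0 < h%:R * u%:R :> R by rewrite mulr_gt0.
apply: lerD.
  apply: (@le_trans _ _ (4 * (5 * t%:R) / k.+1%:R)).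
    by rewrite ler_wpM2r ?invr_ge0 // ler_wpM2l // survival_image_t.
  rewrite mulrA -natrM ler_wpM2l ?mulr_ge0 // lef_pV2 ?posrE // -natrM ler_nat.
  by rewrite /k.
rewrite ler_pdivlMr // /k natrM; set x : R := h%:R * u%:R in huR *.
have x2 : x ^+ 2 <= 4 * (h%:R ^+ 2 * g%:R).
  by rewrite /x exprMn [leRHS]mulrCA ler_wpM2l ?sqr_ge0.
have : x ^+ 2 * (M0%:R ^+ 2 / n%:R) <= 4 * (h%:R ^+ 2 * g%:R) * (1600 * h%:R ^+ 2).
  by apply: ler_pM => //; rewrite ?sqr_ge0 ?M0_sq // divr_ge0 // sqr_ge0.
rewrite [leLHS]mulrA; set y := x ^+ 2 * _ / _ => y_le.
have y0 : 0 <= y by rewrite divr_ge0 // mulr_ge0 ?sqr_ge0.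
have -> : x * (1 + y) * x = x ^+ 2 * (1 + y) by ring.
apply: (@le_trans _ _ (4 * (h%:R ^+ 2 * g%:R) * (1 + 4 * (h%:R ^+ 2 * g%:R) * (1600 * h%:R ^+ 2)))).
  by apply: ler_pM; rewrite ?sqr_ge0 ?addr_ge0 ?lerD2l.
have := @pow_le 2 1 isT isT; have := @pow_le 6 2 isT isT.
have : 0 <= h%:R ^+ 2 * g%:R ^+ 1 :> R by rewrite mulr_ge0 ?exprn_ge0.
have : 0 <= h%:R ^+ 6 * g%:R ^+ 2 :> R by rewrite mulr_ge0 ?exprn_ge0.
rewrite expr1 => q1 q2 q3 q4.
have -> : 4 * (h%:R ^+ 2 * g%:R) * (1 + 4 * (h%:R ^+ 2 * g%:R) * (1600 * h%:R ^+ 2))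
  = 4 * (h%:R ^+ 2 * g%:R) + 100 * 256 * (h%:R ^+ 6 * g%:R ^+ 2) :> R by ring.
lra.
Qed.

Lemma term_short_image : (survival R s * n%:R + s%:R) / Ks%:R <= 1 / (8 * h%:R) :> R.
Proof.
have KR : 0 < Ks%:R :> R by [].
have sR : 0 < s%:R :> R by rewrite ltr0n.
rewrite ler_pdivrMr //; apply: le_trans (survival_image s_gt0 _) _.
  by apply: leq_trans t_le; rewrite leq_exp2r.
have KsE : n%:R <= Ks%:R * (4 * Dr%:R) :> R.
  by rewrite -!natrM ler_nat /Ks ltnW // ltn_ceil // muln_gt0.
have DR : 0 < Dr%:R :> R by rewrite ltr0n.
have sE : s%:R = 160 * h%:R * Dr%:R :> R by rewrite /s -!natrM.
rewrite ler_pdivrMr // sE.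
have -> : 1 / (8 * h%:R) * Ks%:R * (160 * h%:R * Dr%:R) = 5 * (Ks%:R * (4 * Dr%:R)) :> R.
  by field; rewrite lt0r_neq0.
by rewrite ler_wpM2l.
Qed.

Let rR : 80 * h%:R <= r%:R :> R.
Proof. by rewrite -natrM ler_nat. Qed.

Let n_big c : 0 <= c <= (1024 * 1024 * 16) -> c * h%:R <= n%:R :> R.
Proof.
move=> /andP[c0 c1]; have tn : t%:R <= n%:R :> R by rewrite ler_nat.
have := @pow_le 1 0 isT isT; rewrite expr1 expr0 mulr1.
have : c * h%:R <= (1024 * 1024 * 16) * h%:R by rewrite ler_wpM2r.
lra.
Qed.

(** The choice [r = 9 g] works since [n < 2 ^ g] and [8 * (3 / 4) ^ 9 <= 1]. *)
Lemma term_pairs : n%:R ^+ 2 * (3 / 4) ^+ r <= n%:R^-1 :> R.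
Proof.
rewrite -[leRHS]mul1r ler_pdivlMr // mulrAC -exprSr.
apply: (@le_trans _ _ ((2 ^+ g) ^+ 3 * (3 / 4) ^+ r)).
  rewrite ler_wpM2r ?exprn_ge0 ?divr_ge0 //.
  by rewrite lerXn2r ?nnegrE ?exprn_ge0 // -natrX ler_nat ltnW.
rewrite exprAC /r exprM -exprMn exprn_ile1 //; lra.
Qed.

Lemma term_small : 2 / n%:R + r.+1%:R^-1 + (3 * r)%:R ^+ 2 / beta%:R
    + 2 * beta%:R ^+ 2 / n%:R + n%:R ^+ 2 * (3 / 4) ^+ r <= 4 / (8 * h%:R) :> R.
Proof.
have r0 : 0 < r%:R :> R by rewrite ltr0n /r muln_gt0 g_gt0.
have hi0 : 0 < h%:R^-1 :> R by rewrite invr_gt0.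
have e1 : n%:R^-1 <= h%:R^-1 / 100 :> R.
  by rewrite -invfM lef_pV2 ?posrE ?mulr_gt0 // mulrC n_big //; lra.
have e2 : r%:R^-1 <= h%:R^-1 / 80 :> R by rewrite -invfM lef_pV2 ?posrE ?mulr_gt0 // mulrC.
have e3 : r.+1%:R^-1 <= r%:R^-1 :> R by rewrite lef_pV2 ?posrE // ler_nat.
have e4 : (3 * r)%:R ^+ 2 / beta%:R = 9 * r%:R^-1 :> R.
  by rewrite /beta natrM natrX; field; rewrite lt0r_neq0.
have e5 : 2 * beta%:R ^+ 2 / n%:R <= h%:R^-1 / 8 :> R.
  rewrite ler_pdivrMr //; have -> : h%:R^-1 / 8 * n%:R = n%:R / (8 * h%:R) :> R.
    by field; rewrite lt0r_neq0.
  rewrite ler_pdivlMr ?mulr_gt0 //.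
  have : t%:R <= n%:R :> R by rewrite ler_nat.
  have := @pow_le 1 6 isT isT; rewrite expr1 /beta /r natrX natrM -exprM exprMn.
  have : 0 <= h%:R * g%:R ^+ 6 :> R by rewrite mulr_ge0 ?exprn_ge0.
  set y := h%:R * g%:R ^+ 6 => y0 y1 y2.
  have -> : 2 * (9 ^+ 6 * g%:R ^+ 6) * (8 * h%:R) = 16 * 9 ^+ 6 * y :> R by rewrite /y; ring.
  lra.
have := term_pairs; rewrite e4.
have -> : 4 / (8 * h%:R) = h%:R^-1 / 2 :> R by field; rewrite lt0r_neq0.
set p1 := n%:R ^+ 2 * _; set p2 := 2 * _ / _ in e5 *; move: e1 e2 e3 e5 hi0.
move: p1 p2 (n%:R^-1) (r%:R^-1) (r.+1%:R^-1) (h%:R^-1) => *; lra.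
Qed.

Lemma pr_not_typical_le :
  pr R (fun p : {ffun T -> T} * {ffun T -> T} => ~~ typical t k s r D m p.1 p.2) <= h%:R^-1.
Proof.
apply: le_trans (@pr_not_typical R T n_gt0 t k s r D M0 m Ks beta r_small Ks_small _ _ _ _) _.
- by rewrite /M0 !muln_gt0 h_gt0.
- by [].
- by [].
- by rewrite /beta expn_gt0 /r muln_gt0 g_gt0.
have := term_small; have := term_short_image; have := term_stage; have := term_image.
set e1 := _ / M0%:R; set e2 := _ / m%:R; set e3 := _ / Ks%:R; set e4 := 2 / n%:R.
set e5 := r.+1%:R^-1; set e6 := _ / beta%:R; set e7 := 2 * _ / n%:R; set e8 := _ * (3 / 4) ^+ r.
have -> : 1 / (8 * h%:R) = h%:R^-1 / 8 :> R by field; rewrite lt0r_neq0.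
have -> : 2 / (8 * h%:R) = h%:R^-1 / 4 :> R by field; rewrite lt0r_neq0.
have -> : 4 / (8 * h%:R) = h%:R^-1 / 2 :> R by field; rewrite lt0r_neq0.
have : 0 < h%:R^-1 :> R by rewrite invr_gt0.
by move: e1 e2 e3 e4 e5 e6 e7 e8 (h%:R^-1) => *; lra.
Qed.

(** The rounds cost order [t k = h t u]. Merging costs [m ~ t / u] words of length of order [h g],
    which is again of order [h t u] because [g <= u ^ 2]. *)
Lemma sync_length_le : (sync_length t k s r D m)%:R <=
  (4 + 320 * (32 + 1440 * (8 * 1024))) * (h%:R * t%:R * u%:R) :> R.
Proof.
have Dg : (D <= g)%N.
  have /andP[DD _] := D_bounds; rewrite ltnW // -(ltn_exp2l _ _ (isT : 1 < 2)%N).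
  by apply: leq_ltn_trans n_g; rewrite (leq_trans DD) // leq_div.
have mu : m%:R * u%:R <= 320 * t%:R :> R.
  rewrite -!natrM ler_nat /m -mulnA [((t %/ u).+1 * u)%N]mulSn.
  have hu : (u <= t)%N by apply: leq_trans hu_t; rewrite leq_pmull.
  by rewrite -[320%N]/(160 * 2)%N -[leqRHS]mulnA leq_mul2l /= mul2n -addnn leq_add // leq_divM.
have k1 : 1 <= k%:R :> R by rewrite (ler_nat _ 1) /k muln_gt0 h_gt0.
have kE : k%:R = h%:R * u%:R :> R by rewrite /k natrM.
have kt : k%:R <= t%:R :> R by rewrite ler_nat.
have merge : (2 + merging_length s r D)%:R
    <= (32 + 1440 * (8 * 1024)) * (h%:R * u%:R ^+ 2) :> R.
  have gu : g%:R <= u%:R ^+ 2 :> R by rewrite -natrX ler_nat.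
  have ghu : g%:R <= h%:R * u%:R ^+ 2 :> R by rewrite (le_trans gu) // ler_peMl ?sqr_ge0.
  have hg : h%:R * g%:R <= h%:R * u%:R ^+ 2 :> R by rewrite ler_wpM2l.
  have DR : D%:R <= g%:R :> R by rewrite ler_nat.
  have -> : (2 + merging_length s r D)%:R
      = 3 + 27 * g%:R + 2 * D%:R + 1440 * (8 * 1024) * (h%:R * g%:R) :> R.
    have -> : (2 + merging_length s r D = 3 + 27 * g + 2 * D + 160 * h * (1024 * 8 * (9 * g)))%N.
      by rewrite /merging_length /s /Dr /r mulnA -addn1; ring.
    by rewrite !natrD !natrM; ring.
  move: (h%:R * u%:R ^+ 2) ghu hg g1 DR => z.
  by move: (h%:R * g%:R : R) (g%:R : R) (D%:R : R) => *; lra.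
rewrite /sync_length (natrD _ (_ + _)) natrD (natrM _ t) (natrM _ k k.+1) (natrM _ m) -(natr1 k).
have -> : h%:R * t%:R * u%:R = t%:R * k%:R :> R by rewrite kE; ring.
have e1 : t%:R * (k%:R + 1) <= 2 * (t%:R * k%:R) :> R.
  have : t%:R * 1 <= t%:R * k%:R :> R by rewrite ler_wpM2l.
  lra.
have e2 : k%:R * (k%:R + 1) <= 2 * (t%:R * k%:R) :> R.
  by apply: le_trans e1; rewrite ler_wpM2r ?addr_ge0.
have e3 : m%:R * (2 + merging_length s r D)%:R
    <= 320 * (32 + 1440 * (8 * 1024)) * (t%:R * k%:R) :> R.
  apply: (@le_trans _ _ (m%:R * ((32 + 1440 * (8 * 1024)) * (h%:R * u%:R ^+ 2)))).
    by rewrite ler_wpM2l.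
  have -> : m%:R * ((32 + 1440 * (8 * 1024)) * (h%:R * u%:R ^+ 2))
      = (32 + 1440 * (8 * 1024)) * k%:R * (m%:R * u%:R) :> R by rewrite kE; ring.
  have -> : 320 * (32 + 1440 * (8 * 1024)) * (t%:R * k%:R)
      = (32 + 1440 * (8 * 1024)) * k%:R * (320 * t%:R) :> R by ring.
  by apply: ler_wpM2l mu; apply: mulr_ge0; lra.
move: e1 e2 e3; set x := t%:R * (k%:R + 1); set y := k%:R * (_ + 1); set z := m%:R * _.
by move: x y z (t%:R * k%:R) => *; lra.
Qed.

End Scales.

Lemma sqrt_floor n : exists t, (t ^ 2 <= n < t.+1 ^ 2)%N.
Proof.
have ex : exists t, (n < t.+1 ^ 2)%N by exists n; rewrite -mulnn mulSn ltn_addr.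
exists (ex_minn ex); case: ex_minnP => t nt tmin; rewrite nt andbT.
case: t => // t in nt tmin *; rewrite leqNgt; apply/negP => /tmin.
by rewrite ltnn.
Qed.

Lemma sqrt_ceil g : (0 < g)%N -> exists u, (g <= u ^ 2 <= 4 * g)%N.
Proof.
move=> g0; have [u /andP[ug gu]] := sqrt_floor g; exists u.+1; rewrite (ltnW gu) /=.
have : (0 < u)%N by case: u ug gu => // _; rewrite exp1n ltnS leqNgt g0.
by move=> u0; apply: leq_trans (leq_mul (leqnn 4) ug); rewrite -!mulnn; nia.
Qed.

Lemma scales (R : realType) h : (0 < h)%N -> exists n0, forall n, (n0 <= n)%N ->
  exists g t u, [/\ [/\ (1 < n)%N, (n < 2 ^ g)%N & (2 ^ g <= 2 * n)%N],
    (t ^ 2 <= n < t.+1 ^ 2)%N, (g <= u ^ 2 <= 4 * g)%N, (80 * h <= 9 * g)%N &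
    (1024 * 1024 * 16) * h%:R ^+ 6 * g%:R ^+ 6 <= t%:R :> R].
Proof.
move=> h0; pose K := Num.truncn ((1024 * 1024 * 16) * h%:R ^+ 6 : R).
have KR : (1024 * 1024 * 16) * h%:R ^+ 6 <= K.+1%:R :> R by rewrite ltW // truncnS_gt.
(* The goal [K.+1 * g ^ 6 <= t] is squared; as [2 ^ g <= 2 n] and [n < (t + 1) ^ 2], it follows from
   [2 (K + 1) ^ 2 g ^ 12 <= 2 ^ g]. *)
have [g0 g0P] := poly_le_exp (2 * K.+1 ^ 2) 12.
exists (2 ^ (g0 + 80 * h))%N => n n_ge.
have n1 : (1 < n)%N.
  by apply: leq_trans n_ge; rewrite (@leq_exp2l 2 1) //; lia.
pose g := (trunc_log 2 n).+1.
have /andP[n_lo n_hi] := trunc_log_bounds (isT : 1 < 2)%N (ltnW n1).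
have g_ge : (g0 + 80 * h < g)%N.
  by rewrite -(ltn_exp2l _ _ (isT : 1 < 2)%N) (leq_ltn_trans n_ge).
have [t t_b] := sqrt_floor n; have [u u_b] := @sqrt_ceil g isT.
exists g, t, u; split => //; first by split => //; rewrite /g expnS leq_mul2l.
  by move: g_ge; clear; lia.
have Kt : (K.+1 * g ^ 6 <= t)%N.
  rewrite -ltnS -(ltn_exp2r _ _ (isT : 0 < 2)%N); apply: leq_ltn_trans (proj2 (andP t_b)).
  apply: leq_trans n_lo; rewrite -(leq_pmul2l (isT : 0 < 2)%N) -expnS -/g expnMn mulnA -expnM.
  by apply: g0P; move: g_ge; clear; lia.
by apply: le_trans (_ : (K.+1 * g ^ 6)%:R <= _); rewrite ?ler_nat // natrM natrX ler_wpM2r // exprn_ge0.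
Qed.

Lemma ln_scale (R : realType) (n g : nat) : (1 < n)%N -> (2 ^ g <= 2 * n)%N ->
  g%:R <= 4 * ln n%:R :> R.
Proof.
move=> n1 gn; have n0 : 0 < n%:R :> R by rewrite ltr0n ltnW.
have l2 : 1 / 2 <= ln 2 :> R.
  rewrite -ler_expR lnK ?posrE // -[leRHS]invrK -[leLHS]invrK.
  rewrite lef_pV2 ?posrE ?invr_gt0 ?expR_gt0 // -expRN.
  by apply: le_trans (expR_ge1Dx _); lra.
have : g%:R * ln 2 <= 2 * ln n%:R :> R.
  rewrite !mulr_natl -!lnXn // ler_ln ?posrE ?exprn_gt0 // -!natrX ler_nat.
  by rewrite (leq_trans gn) // -mulnn leq_mul2r n1 orbT.
have : g%:R * (1 / 2) <= g%:R * ln 2 :> R by rewrite ler_wpM2l.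
lra.
Qed.

(** * Random automata as pairs of independent random maps *)

Section Automata.
Variable n : nat.
Notation FT := {ffun 'I_n -> 'I_n}.

Definition letters (d : automaton n) : FT * FT :=
  ([ffun x => d (x, false)], [ffun x => d (x, true)]).

Lemma letters_inj : injective letters.
Proof.
move=> d1 d2 [/ffunP e1 /ffunP e2]; apply/ffunP => -[x []].
  by have := e2 x; rewrite !ffunE.
by have := e1 x; rewrite !ffunE.
Qed.

Lemma delta_wordE (d : automaton n) w x :
  delta_word d w x = run (letters d).1 (letters d).2 w x.
Proof. by elim: w x => //= c w IH x; rewrite IH; case: c; rewrite ffunE. Qed.

Lemma card_automaton : #|{: automaton n}| = #|{: FT * FT}|.
Proof. by rewrite card_prod !card_ffun card_prod card_bool card_ord muln2 -addnn expnD. Qed.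

Lemma uniform_pr_ge (R : realType) (P : pred (FT * FT)) (E : {set automaton n}) :
  (0 < n)%N -> (forall d, P (letters d) -> d \in E) ->
  1 - pr R (predC P) <= uniform_pr R E.
Proof.
move=> n0 PE; have FT0 : (0 < #|{: FT * FT}|)%N.
  by rewrite card_prod muln_gt0 !card_ffun !expn_gt0 card_ord n0.
rewrite -(prC _ _ FT0) prE /uniform_pr card_automaton ler_wpM2r ?invr_ge0 // ler_nat.
have [inv _ invK] : bijective letters by apply: inj_card_bij letters_inj _; rewrite card_automaton.
rewrite -(card_imset E letters_inj) subset_leq_card //.
apply/subsetP => p pP; apply/imsetP; exists (inv p); rewrite ?invK //.
by apply: PE; rewrite invK.
Qed.

End Automata.

Theorem corollary1p4 (R : realType) :
  exists2 C : R, 0 < C &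
    forall eps : R, 0 < eps <= 1 ->
      exists n0 : nat, forall n : nat, (n0 <= n)%N ->
        uniform_pr R [set delta : automaton n |
          (shortest_sync R delta <= (C * eps^-1 * Num.sqrt (n%:R * ln n%:R))%:E)%E]
        >= 1 - eps.
Proof.
pose c0 : R := 4 + 320 * (32 + 1440 * (8 * 1024)).
have c00 : 0 < c0 by rewrite /c0; lra.
(* The factor 8 is the product of 2 from [h <= 2 / eps] and 4 from [u <= 4 sqrt (ln n)]. *)
exists (8 * c0); first by rewrite mulr_gt0.
move=> eps /andP[eps0 eps1].
pose h := (Num.truncn eps^-1).+1.
have h_ge : eps^-1 <= h%:R by rewrite ltW // truncnS_gt.
have ei1 : 1 <= eps^-1 by rewrite invf_ge1.
have h_le : h%:R <= 2 * eps^-1.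
  have : (Num.truncn eps^-1)%:R <= eps^-1 by rewrite truncn_le // ltW // invr_gt0.
  rewrite /h -natr1; lra.
have [n0 n0P] := @scales R h isT; exists n0 => n /n0P.
move=> [g [t [u [[n1 ng gn] /andP[t_lo t_hi] /andP[u_lo u_hi] gh tL]]]].
have n_gt0 : (0 < n)%N by exact: ltnW.
have cI : #|'I_n| = n by rewrite card_ord.
pose P (p : {ffun 'I_n -> 'I_n} * {ffun 'I_n -> 'I_n}) :=
  typical t (h * u) (160 * h * (1024 * 8 * (9 * g))) (9 * g)
     (trunc_log 2 (#|'I_n| %/ (1024 * 8 * (9 * g)))) (160 * (t %/ u).+1) p.1 p.2.
have prP : pr R (predC P) <= eps.
  apply: (@le_trans _ _ h%:R^-1).
    by apply: pr_not_typical_le => //; rewrite card_ord.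
  by rewrite invf_ple ?posrE ?ltr0n.
apply: (@le_trans _ _ (1 - pr R (predC P))); first by rewrite lerD2l lerN2.
apply: uniform_pr_ge => // d Pd; rewrite inE.
have T0 : (0 < #|'I_n|)%N by rewrite card_ord.
have [w w_le w1] := typical_sync T0 Pd.
apply: (@le_trans _ _ (size w)%:R%:E).
  apply: ereal_inf_lbound; exists w => //=; rewrite /synchronizing -w1.
  by apply/eqP; congr #|pred_of_set _|; apply: eq_imset => x; rewrite delta_wordE.
rewrite lee_fin; have : (size w)%:R <= c0 * (h%:R * t%:R * u%:R) :> R.
  apply: le_trans (sync_length_le (R := R) (T := 'I_n) (h := h) (g := g) (t := t) (u := u)
    isT _ _ u_lo u_hi gh tL); rewrite ?ler_nat // card_ord //.
move=> /le_trans; apply.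
have ln0 : 0 <= ln n%:R :> R by rewrite ln_ge0 // (ler_nat _ 1).
have t_sqrt : t%:R <= Num.sqrt n%:R :> R.
  by rewrite -(@ler_sqr R) ?nnegrE ?sqrtr_ge0 // sqr_sqrtr // -natrX ler_nat.
have u_sqrt : u%:R <= 4 * Num.sqrt (ln n%:R) :> R.
  rewrite -(@ler_sqr R) ?nnegrE ?mulr_ge0 ?sqrtr_ge0 // exprMn sqr_sqrtr //.
  apply: (@le_trans _ _ (4 * g%:R)); first by rewrite -natrX -natrM ler_nat.
  by have := ln_scale R n1 gn; move: (g%:R : R) (ln n%:R : R) => *; lra.
rewrite sqrtrM ?ler0n // [8 * c0]mulrC -!mulrA ler_wpM2l ?(ltW c00) //.
have -> : 8 * (eps^-1 * (Num.sqrt n%:R * Num.sqrt (ln n%:R)))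
  = 2 * eps^-1 * (Num.sqrt n%:R * (4 * Num.sqrt (ln n%:R))) :> R by ring.
by apply: ler_pM => //; apply: ler_pM.
Qed.
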